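(* For $p\in(1,\infty)$ define $\delta_p$ as follows: if $2\le p<\infty$, $\delta_p:=1-(1-4^{-p})^{1/p}$; if $1<p<2$, $\delta_p$ is the unique $\delta\in[0,1]$ such that $(1-\delta+\tfrac14)^p+|1-\delta-\tfrac14|^p=2$. Then $\delta_p>0$ for every $p\in(1,\infty)$, and for every $d\ge 2$ the unit ball $B^d_p=\{x\in\mathbb{R}^d: \sum_{j=1}^d|x_j|^p\le 1\}$ of the $\ell^p$ norm satisfies $$f(B^d_p)\geq \left(2^d+(3-2\delta_p)^d\right)^{-1}$$ and $$F(B^d_p)\geq (e+o(1))^{-1}(d\log d)^{-1}\left(2^d+(3-2\delta_p)^d\right)^{-1}=(3-2\delta_p)^{-d+o(d)},$$ where the asymptotic notation refers to $d\to\infty$ (with $p$ fixed).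
   Context: For measurable $E\subseteq\mathbb{R}^d$, $|E|$ denotes Lebesgue measure. A symmetric convex body $K\subseteq\mathbb{R}^d$ is the closed unit ball of a norm on $\mathbb{R}^d$. The constant $F(K)$ is the largest $c\ge 0$ such that every finite collection $\mathcal{C}$ of homothetic copies of $K$ (sets $v+\lambda K$ with $v\in\mathbb{R}^d$, $\lambda>0$) admits a sub-collection $\mathcal{S}\subseteq\mathcal{C}$ of pairwise disjoint sets with $|\bigcup_{K'\in\mathcal{S}}K'|\ge c\,|\bigcup_{K'\in\mathcal{C}}K'|$. The constant $f(K)$ is defined in the same way, with $\mathcal{C}$ ranging only over finite collections of translates of $K$. The symbol $\log$ is the natural logarithm. The term $o(1)$ is a function of $d$ tending to $0$ as $d\to\infty$. *)

(* Defs.v *)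
From HB Require Import structures.
From mathcomp Require Import all_boot all_order all_algebra.
From mathcomp Require Import all_classical all_reals all_analysis.

Set Implicit Arguments.
Unset Strict Implicit.
Unset Printing Implicit Defensive.

Import Order.TTheory GRing.Theory Num.Theory.
Import numFieldNormedType.Exports.

Local Open Scope classical_set_scope.
Local Open Scope ring_scope.

Section Volume.
Context {R : realType}.

(* The n-fold product of one-dimensional Lebesgue measure. *)
Fixpoint lebesgue_tuple (n : nat) :
    set (n.-tuple (measurableTypeR R)) -> \bar R :=
  match n with
  | 0%N => \d_[tuple]
  | m.+1 => pushforward (lebesgue_measure \x lebesgue_tuple (n := m))%E
              (fun xt => [tuple of xt.1 :: xt.2])
  end.

(* Only meaningful on Borel sets; below it is applied to finite unions of
   homothetic copies of a compact set. *)
Definition volume (d : nat) (E : set 'rV[R]_d) : \bar R :=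
  lebesgue_tuple [set t : d.-tuple (measurableTypeR R)
                 | E (\row_(i < d) tnth t i)].

End Volume.

Section Vitali.
Context {R : realType} {d : nat}.
Implicit Types (K : set 'rV[R]_d) (P : set (set 'rV[R]_d)) (c : R).

Definition homothetic_copies K : set (set 'rV[R]_d) :=
  [set K' | exists (v : 'rV[R]_d) (lambda : R),
      0 < lambda /\ K' = [set v + lambda *: x | x in K]].

Definition translates K : set (set 'rV[R]_d) :=
  [set K' | exists v : 'rV[R]_d, K' = [set v + x | x in K]].

Definition disjoint_fraction P c : Prop :=
  0 <= c /\
  forall C : set (set 'rV[R]_d), finite_set C -> C `<=` P ->
    exists S : set (set 'rV[R]_d),
      [/\ S `<=` C, trivIset S id &
          (c%:E * volume (\bigcup_(K' in C) K')
             <= volume (\bigcup_(K' in S) K'))%E].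

(* The largest admissible c; the default 0 is used only when there is none. *)
Definition largest_disjoint_fraction P : R :=
  xget 0 (disjoint_fraction P `&` ubound (disjoint_fraction P)).

Definition Fconst K : R := largest_disjoint_fraction (homothetic_copies K).

Definition fconst K : R := largest_disjoint_fraction (translates K).

End Vitali.

Section Lp.
Context {R : realType}.
Implicit Types p delta : R.

Definition lp_ball (d : nat) p : set 'rV[R]_d :=
  [set x | \sum_(j < d) `|x ord0 j| `^ p <= 1].

Definition lp_delta_equation p delta : Prop :=
  0 <= delta <= 1 /\
  (1 - delta + 4^-1) `^ p + `|1 - delta - 4^-1| `^ p = 2.

Definition lp_delta p : R :=
  if 2 <= p then 1 - (1 - 4 `^ (- p)) `^ p^-1
  else xget 0 [set delta | lp_delta_equation p delta].

End Lp.

Arguments lp_ball {R} d p.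

(* Main.v *)
(* For translates of radius r, take a disjoint subfamily S of maximum cardinality.
   A point x of the ball of w that is at distance more than (3 - 2 delta) r from
   the centers of S determines, by uniform convexity, the approximate position of
   every v in S whose ball meets that of w; hence there is exactly one such v.
   By maximality the w attached to a given v have pairwise distances at most 2r,
   so their balls form a set of diameter at most 4r, whose volume is at most
   2^d times that of one ball by the isodiametric inequality.  The latter follows
   from Steiner symmetrization along the coordinate axes, under which the l^p ball
   is invariant.  For p < 2, delta is estimated by Hanner's inequality, for
   p >= 2 by Clarkson's.  Homothetic copies reduce to translates by rounding the
   radii to powers of e^(1/d), keeping one residue class of the exponents modulo
   about d ln d, and selecting greedily from large to small radii. *)

Require Import Defs.
From HB Require Import structures.
From mathcomp Require Import all_boot all_order all_algebra.
From mathcomp Require Import all_classical all_reals all_analysis.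
From mathcomp Require Import measurable_realfun ring lra.

Set Implicit Arguments.
Unset Strict Implicit.
Unset Printing Implicit Defensive.

Import Order.TTheory GRing.Theory Num.Theory.
Import numFieldNormedType.Exports.

Local Open Scope classical_set_scope.
Local Open Scope ring_scope.

(** * Two-point inequalities and delta_p *)

Section PowerInequalities.
Context {R : realType}.
Implicit Types p q r s t x y z : R.

(** With a = (c w - c v)/(2r) and u = (x - c w)/r, both in the unit ball, x - c v = r(2a + u). If a
    - u has norm at least 1/2, its half has norm at least 1/4, the number in the equation for
    delta_p; then a + u has norm at most 2(1 - delta_p), and 1 + 2(1 - delta_p) is the dilation
    factor 3 - 2 delta_p. If the norm is below 1/2, then c v is within r of 3 c w - 2x, a point that
    does not depend on v, and two such v would be less than 2r apart. Thus 1/2 is the largest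
    threshold at which the triangle inequality still contradicts separation. A family that is merely
    maximal under inclusion would not do: removing one center and inserting two enlarges a family
    only in cardinality. In the bound for F, the factor e is (e^(1/d))^d, the price in volume of
    rounding radii up by at most e^(1/d). *)

Lemma powR_convex p t x y : 1 <= p -> 0 <= t <= 1 -> 0 <= x -> 0 <= y ->
  (t * x + (1 - t) * y) `^ p <= t * x `^ p + (1 - t) * y `^ p.
Proof.
move=> p1 t01 x0 y0.
have := @convex_powR R p p1 (Itv01 (andP t01).1 (andP t01).2) x y.
rewrite !inE /= !in_itv /= !andbT => /(_ x0 y0).
by rewrite !convRE.
Qed.

Lemma powR_midpoint_le p x y : 1 <= p -> 0 <= x -> 0 <= y ->
  2 * ((x + y) / 2) `^ p <= x `^ p + y `^ p.
Proof.
move=> p1 x0 y0.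
have h : 0 <= (2^-1 : R) <= 1 by apply/andP; split; lra.
have := powR_convex p1 h x0 y0.
have -> : 2^-1 * x + (1 - 2^-1) * y = (x + y) / 2 by field.
lra.
Qed.

Lemma ge1r_powR_le p x : 1 <= p -> 0 <= x -> x <= 1 -> x `^ p <= x.
Proof.
move=> p1 x0 x1; have [->|xn] := eqVneq x 0.
  by rewrite powR0// gt_eqF// (lt_le_trans ltr01).
by rewrite ge1r_powR// lt_neqAle eq_sym xn x0.
Qed.

Lemma powR_superadditive p x y : 1 <= p -> 0 <= x -> 0 <= y ->
  x `^ p + y `^ p <= (x + y) `^ p.
Proof.
move=> p1 x0 y0.
have p0 : 0 < p by lra.
have xy0 : 0 <= x + y by lra.
rewrite -(mulr_powRB1 x0 p0) -(mulr_powRB1 y0 p0) -(mulr_powRB1 xy0 p0) mulrDl.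
apply: lerD; apply: ler_wpM2l => //; apply: ge0_ler_powR;
  rewrite ?nnegrE ?lerDl ?lerDr //; lra.
Qed.

Lemma powR_subadditive q x y : 0 < q -> q <= 1 -> 0 <= x -> 0 <= y ->
  (x + y) `^ q <= x `^ q + y `^ q.
Proof.
move=> q0 q1 x0 y0.
have qi : 1 <= q^-1 by rewrite invf_ge1.
have := powR_superadditive qi (powR_ge0 x q) (powR_ge0 y q).
rewrite -!powRrM mulfV ?gt_eqF// !powRr1// => h.
have := ge0_ler_powR (ltW q0) _ _ h.
rewrite -powRrM mulVf ?gt_eqF// powRr1 ?addr_ge0 ?powR_ge0//; apply.
  by rewrite nnegrE addr_ge0.
by rewrite nnegrE powR_ge0.
Qed.

(** Written in terms of squares, this is convexity and superadditivity of the power [p / 2], which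
    is at least 1, combined with the parallelogram identity. *)
Lemma clarkson_scalar p x y : 2 <= p ->
  2 * `|x| `^ p + 2 * `|y| `^ p <= `|x + y| `^ p + `|x - y| `^ p.
Proof.
move=> p2.
have h1 : 1 <= p / 2 by lra.
have E z : `|z| `^ p = (z ^+ 2) `^ (p / 2).
  rewrite -real_normK ?num_real// -powR_mulrn// -powRrM.
  by congr (_ `^ _); field.
rewrite !E.
have := powR_midpoint_le h1 (sqr_ge0 (x + y)) (sqr_ge0 (x - y)).
have -> : ((x + y) ^+ 2 + (x - y) ^+ 2) / 2 = x ^+ 2 + y ^+ 2 by field.
have := powR_superadditive h1 (sqr_ge0 x) (sqr_ge0 y).
lra.
Qed.

Lemma continuous_norm_powR p : 0 < p -> continuous (fun x : R => `|x| `^ p).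
Proof.
move=> p0 x; have [->|x0] := eqVneq x 0.
  rewrite /continuous_at normr0 powR0 ?gt_eqF//.
  apply/cvgrPdist_lt => e e0; near=> y.
  rewrite sub0r normrN ger0_norm ?powR_ge0//.
  have -> : e = (e `^ p^-1) `^ p.
    by rewrite -powRrM mulVf ?gt_eqF// powRr1// ltW.
  apply: gt0_ltr_powR => //; rewrite ?nnegrE ?powR_ge0//.
  near: y; apply: (@nbhs0_lt _ R^o); exact: powR_gt0.
have : {for `|x|, continuous (fun z : R => z `^ p)}.
  apply/differentiable_continuous/derivable1_diffP.
  by apply: derivable_powR; rewrite in_itv/= normr_gt0 x0.
move=> h; apply: (continuous_comp _ h); exact: norm_continuous.
Unshelve. all: end_near. Qed.

Lemma is_derive_norm_powR p x : x != 0 ->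
  is_derive x 1 (fun z : R => `|z| `^ p) (p * (Num.sg x * `|x| `^ (p - 1))).
Proof.
move=> x0; have [xp|xn|x0'] := ltgtP x 0; last by rewrite x0' eqxx in x0.
  rewrite ltr0_sg// ltr0_norm//.
  have h : 0 < - x by rewrite oppr_gt0.
  have d1 := is_derive1_powR p h.
  apply: (@near_eq_is_derive _ _ _ (fun z : R => (- z) `^ p)); rewrite ?oner_neq0//.
    near=> z; rewrite ltr0_norm//; near: z; exact: lt_nbhsl.
  have d2 : is_derive x 1 (-%R : R -> R) (- 1) by exact: is_deriveNid.
  have h2 := @is_derive1_comp R (fun z : R => z `^ p) (fun z : R => - z) x _ _ d1 d2.
  refine (is_derive_eq h2 _).
  by ring.
rewrite gtr0_sg// gtr0_norm//.
apply: (@near_eq_is_derive _ _ _ (fun z : R => z `^ p)); rewrite ?oner_neq0//.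
  near=> z; rewrite gtr0_norm//; near: z; exact: lt_nbhsr.
apply: is_derive_eq; first exact: is_derive1_powR.
by rewrite mul1r.
Unshelve. all: end_near. Qed.

Lemma is_derive_norm_powR_shift p c x : x + c != 0 ->
  is_derive x 1 (fun z : R => `|z + c| `^ p)
    (p * (Num.sg (x + c) * `|x + c| `^ (p - 1))).
Proof.
move=> xc0.
have d1 := is_derive_norm_powR p xc0.
have d2 := is_deriveD (is_derive_id x (1 : R)) (is_derive_cst c x (1 : R)).
have h := @is_derive1_comp R (fun z : R => `|z| `^ p) (fun z : R => z + c) x _ _ d1 d2.
by refine (is_derive_eq h _); rewrite addr0 mulr1.
Qed.

Lemma continuous_norm_powR_shift p c : 0 < p ->
  continuous (fun x : R => `|x + c| `^ p).
Proof.
move=> p0 x; apply: (@continuous_comp _ _ _ (fun x : R => x + c) (fun z : R => `|z| `^ p)).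
  by apply: continuousD; [exact: cvg_id|exact: cvg_cst].
exact: continuous_norm_powR.
Qed.

End PowerInequalities.

(** * Hanner's inequality on the real line, for exponents between 1 and 2 *)

Section Hanner.
Context {R : realType}.
Implicit Types p q r s t x y z : R.

(** Concavity of the power [q]: moving 1 + s and 1 - s apart lowers the sum. It decides the sign of
    the derivative in [hanner_scalar1]. *)
Lemma powR_onepm_nincr q s t : 0 < q -> q <= 1 -> 0 <= s -> s <= t -> t <= 1 ->
  (1 + t) `^ q + (1 - t) `^ q <= (1 + s) `^ q + (1 - s) `^ q.
Proof.
move=> q0 q1 s0 st t1.
pose f z := `|z + 1| `^ q + `|z - 1| `^ q.
have fE z : 0 <= z -> z <= 1 -> f z = (1 + z) `^ q + (1 - z) `^ q.
  move=> z0 z1; rewrite /f ger0_norm ?addr_ge0// distrC ger0_norm ?subr_ge0//.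
  by rewrite [z + 1]addrC.
rewrite -!fE//; try lra.
have fd z : 0 < z < 1 ->
    is_derive z 1 f (q * (1 + z) `^ (q - 1) - q * (1 - z) `^ (q - 1)).
  move=> /andP[z0 z1].
  have h1 : z + 1 != 0 by rewrite gt_eqF//; lra.
  have h2 : z - 1 != 0 by rewrite lt_eqF//; lra.
  have d1 := is_derive_norm_powR_shift q h1.
  have d2 := is_derive_norm_powR_shift q h2.
  refine (is_derive_eq (is_deriveD d1 d2) _).
  rewrite (gtr0_sg (_ : 0 < z + 1)) ?(ltr0_sg (_ : z - 1 < 0)); try lra.
  rewrite (gtr0_norm (_ : 0 < z + 1)) ?(ltr0_norm (_ : z - 1 < 0)); try lra.
  by rewrite opprB (addrC z); ring.
have fc : continuous f.
  by move=> z; apply: cvgD; exact: continuous_norm_powR_shift.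
apply: (@ler0_derive1_nincr R f 0 1) => //.
- by move=> z; rewrite in_itv/= => /fd[].
- move=> z; rewrite in_itv/= => z01; have d := fd z z01.
  rewrite derive1E derive_val.
  rewrite -mulrBr pmulr_rle0// subr_le0.
  rewrite -[q - 1]opprB !powRN lef_pV2 ?posrE ?powR_gt0; try lra.
  by apply: ge0_ler_powR; rewrite ?nnegrE; lra.
- exact: continuous_subspaceT.
Qed.

(** As a function of [z ^ p], the left side is the tangent line to the right side at z = 1/r; this
    is where the two coefficients come from. *)
Lemma hanner_scalar1 p r z : 1 < p -> p < 2 -> 0 < r -> r < 1 -> 0 <= z ->
  ((1 + r) `^ (p - 1) + (1 - r) `^ (p - 1)) * z `^ p
    + ((1 + r) `^ (p - 1) - (1 - r) `^ (p - 1)) / r `^ (p - 1)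
  <= (z + 1) `^ p + `|z - 1| `^ p.
Proof.
move=> p1 p2 r0 r1 z0; set q := p - 1.
have q0 : 0 < q by rewrite /q; lra.
have q1 : q <= 1 by rewrite /q; lra.
set a := (_ + _ `^ q); set b := (_ / _).
(* f vanishes at 1/r, decreases before and increases after. *)
pose f z := `|z + 1| `^ p + `|z - 1| `^ p - a * `|z| `^ p - b.
suff : 0 <= f z by rewrite /f !(ger0_norm z0) (@ger0_norm _ (z + 1)); lra.
have fr : f r^-1 = 0.
  have ri : 1 < r^-1 by rewrite invf_gt1.
  rewrite /f !ger0_norm; try lra.
  have -> : r^-1 + 1 = (1 + r) / r by field; lra.
  have -> : r^-1 - 1 = (1 - r) / r by field; lra.
  have E y : 0 <= y -> y `^ p = y * y `^ q by move=> ?; rewrite mulr_powRB1//; lra.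
  have ri0 : 0 <= r^-1 by lra.
  rewrite !powRM; try lra.
  rewrite (E (1 + r)); last lra.
  rewrite (E (1 - r)); last lra.
  rewrite (E r^-1)// /b /a.
  rewrite -[r^-1 `^ q]mulr1.
  have -> : r^-1 `^ q = (r `^ q)^-1.
    by rewrite -powR_inv1 ?(ltW r0)// -powRrM mulrC powRrM powR_inv1 ?powR_ge0.
  have rq : r `^ q != 0 by rewrite gt_eqF// powR_gt0.
  field.
  by rewrite rq gt_eqF.
have fc : continuous f.
  move=> y; apply: cvgB; last exact: cvg_cst.
  apply: cvgB; last first.
    by apply: cvgM; [exact: cvg_cst|apply: continuous_norm_powR; lra].
  by apply: cvgD; apply: continuous_norm_powR_shift; lra.
have fd y : 0 < y -> y != 1 -> is_derive y 1 f
    (p * ((y + 1) `^ q + Num.sg (y - 1) * `|y - 1| `^ q - a * y `^ q)).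
  move=> y0 y1.
  have h1 : y + 1 != 0 by rewrite gt_eqF//; lra.
  have h2 : y - 1 != 0 by rewrite subr_eq0.
  have h3 : y != 0 by rewrite gt_eqF.
  have d1 := is_derive_norm_powR_shift p h1.
  have d2 := is_derive_norm_powR_shift p h2.
  have d3 := @is_deriveZ _ _ _ _ a y 1 _ (is_derive_norm_powR p h3).
  have d4 := is_deriveB (is_deriveB (is_deriveD d1 d2) d3) (is_derive_cst b y 1).
  refine (is_derive_eq d4 _).
  rewrite /GRing.scale/= (gtr0_sg y0) (gtr0_norm y0).
  rewrite (@gtr0_sg _ (y + 1)) ?(@gtr0_norm _ (y + 1)); try lra.
have fdb y : 0 < y -> y != 1 -> derivable f y 1.
  by move=> y0 y1; have [] := fd y y0 y1.
clearbody f b.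
have f1 : 1 < r^-1 by rewrite invf_gt1.
have dle1 y : 0 < y -> y < 1 -> derive1 f y <= 0.
  move=> y0 y1; have y1' : y != 1 by rewrite lt_eqF.
  have d := fd y y0 y1'.
  rewrite derive1E derive_val pmulr_rle0 ?ltr0_sg ?ltr0_norm; try lra.
  (* Subadditivity, used twice, gives (y + 1)^q - (1 - y)^q <= 2^q y^q <= a y^q, so f decreases on
     (0, 1). *)
  have ha : 2 `^ q <= a.
    have := powR_subadditive q0 q1 (_ : 0 <= 1 + r) (_ : 0 <= 1 - r).
    have -> : 1 + r + (1 - r) = 2 :> R by ring.
    by apply; lra.
  have hb : (y + 1) `^ q <= (1 - y) `^ q + (2 * y) `^ q.
    have := powR_subadditive q0 q1 (_ : 0 <= 1 - y) (_ : 0 <= 2 * y).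
    have -> : 1 - y + 2 * y = y + 1 :> R by ring.
    by apply; lra.
  rewrite powRM in hb; try lra.
  have := ler_wpM2r (powR_ge0 y q) ha.
  have -> : - (y - 1) = 1 - y by ring.
  lra.
have dgt1 y : 1 < y -> derive1 f y = p * y `^ q * ((1 + y^-1) `^ q + (1 - y^-1) `^ q - a).
  move=> y1.
  have d := fd y (lt_trans ltr01 y1) (negbT (gt_eqF y1)).
  rewrite derive1E derive_val gtr0_sg ?gtr0_norm; try lra.
  have yi : 0 < y^-1 < 1 by rewrite invr_gt0 invf_lt1; lra.
  have -> : y + 1 = y * (1 + y^-1) by field; lra.
  have -> : y - 1 = y * (1 - y^-1) by field; lra.
  rewrite !powRM; try lra.
have [zr|rz] := leP z r^-1; last first.
  rewrite -fr; apply: (@ger0_derive1_ndecr R f r^-1 z) => //; try lra.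
  - move=> y; rewrite in_itv/= => /andP[ry yz].
    by apply: fdb; [lra|rewrite gt_eqF//; lra].
  - move=> y; rewrite in_itv/= => /andP[ry yz].
    rewrite dgt1; last lra.
    apply: mulr_ge0; first by rewrite mulr_ge0 ?powR_ge0//; lra.
    rewrite subr_ge0; apply: powR_onepm_nincr => //; rewrite ?invr_ge0; try lra.
    by rewrite invf_ple ?posrE; lra.
  - exact: continuous_subspaceT.
(* The derivative formula excludes the point 1, so the decrease towards 1/r is followed on [1, 1/r]
   and on [0, 1] separately; the maximum treats z on either side of 1 at once. *)
have h1r : f r^-1 <= f (Num.max z 1).
  apply: (@ler0_derive1_nincr R f 1 r^-1) => //.
  - move=> y; rewrite in_itv/= => /andP[ry yz].
    by apply: fdb; [lra|rewrite gt_eqF//; lra].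
  - move=> y; rewrite in_itv/= => /andP[y1 yr].
    rewrite dgt1; last lra.
    rewrite pmulr_rle0; last by rewrite mulr_gt0 ?powR_gt0//; lra.
    rewrite subr_le0; apply: powR_onepm_nincr => //; try lra.
      by rewrite invf_pge ?posrE ?(ltW yr)//; lra.
    by rewrite invf_le1; lra.
  - exact: continuous_subspaceT.
  - by rewrite le_max lexx orbT.
  - by rewrite ge_max zr ltW.
rewrite -fr (le_trans h1r)//.
have [z1|z1] := leP z 1; last by [].
apply: (@ler0_derive1_nincr R f 0 1) => //.
- move=> y; rewrite in_itv/= => /andP[ry yz].
  by apply: fdb; [lra|rewrite lt_eqF//; lra].
- by move=> y; rewrite in_itv/= => /andP[]; exact: dle1.
- exact: continuous_subspaceT.
Qed.

(** Obtained by homogeneity from [hanner_scalar1]. Being linear in the p-th powers for a fixed [r],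
    it can be summed over coordinates; optimizing [r] afterwards is what yields Hanner's inequality
    for norms. *)
Lemma hanner_scalar p r x y : 1 < p -> p < 2 -> 0 < r -> r < 1 ->
  ((1 + r) `^ (p - 1) + (1 - r) `^ (p - 1)) * `|x| `^ p
    + ((1 + r) `^ (p - 1) - (1 - r) `^ (p - 1)) / r `^ (p - 1) * `|y| `^ p
  <= `|x + y| `^ p + `|x - y| `^ p.
Proof.
move=> p1 p2 r0 r1.
have p0 : p != 0 by rewrite gt_eqF//; lra.
have [->|y0] := eqVneq y 0.
  rewrite normr0 powR0// mulr0 addr0 subr0.
  suff : (1 + r) `^ (p - 1) + (1 - r) `^ (p - 1) <= 2.
    by move/(ler_wpM2r (powR_ge0 `|x| p)); rewrite addr0; lra.
  have := @powR_onepm_nincr (p - 1) 0 r.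
  by rewrite addr0 subr0 powR1; apply; lra.
have yp : 0 < `|y| by rewrite normr_gt0.
have E : `|x + y| `^ p + `|x - y| `^ p
    = (`|x| + `|y|) `^ p + `| `|x| - `|y| | `^ p.
  have [xs|xs] := leP 0 x; have [ys|ys] := leP 0 y.
  - by rewrite (ger0_norm xs) (ger0_norm ys) (@ger0_norm _ (x + y)); [|lra].
  - rewrite (ger0_norm xs) (ltr0_norm ys) (@ger0_norm _ (x - y)); last lra.
    by rewrite opprK addrC.
  - rewrite (ltr0_norm xs) (ger0_norm ys) (@ltr0_norm _ (x - y)); last lra.
    have -> : `|- x - y| = `|x + y| by rewrite -normrN; congr `|_|; ring.
    by rewrite addrC; congr (_ `^ _ + _); ring.
  - rewrite (ltr0_norm xs) (ltr0_norm ys) (@ltr0_norm _ (x + y)); last lra.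
    have -> : `|- x - - y| = `|x - y| by rewrite -normrN; congr `|_|; ring.
    by congr (_ `^ _ + _); ring.
rewrite E.
have z0 : 0 <= `|x| / `|y| by rewrite divr_ge0.
have := ler_wpM2r (powR_ge0 `|y| p) (hanner_scalar1 p1 p2 r0 r1 z0).
have -> : `|x| / `|y| + 1 = (`|x| + `|y|) / `|y| by field; rewrite gt_eqF.
have -> : `|x| / `|y| - 1 = (`|x| - `|y|) / `|y| by field; rewrite gt_eqF.
rewrite [`|_ / _|]normf_div normr_id.
have M s : 0 <= s -> (s / `|y|) `^ p * `|y| `^ p = s `^ p.
  move=> s0; rewrite -powRM ?divr_ge0// divfK// gt_eqF//.
rewrite -(M `|x|)// -(M (`|x| + `|y|)) ?addr_ge0// -(M `| `|x| - `|y| |)//.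
lra.
Qed.

End Hanner.

(** * Existence, uniqueness and bounds for delta_p *)

Section Delta.
Context {R : realType}.
Implicit Types p q r s t x y z : R.

(** Bernoulli's inequality in strict form, by the mean value theorem; strictness is what excludes
    delta = 0 below. *)
Lemma powR_gt_tangent p x : 1 < p -> -1 < x -> x != 0 -> 1 + p * x < (1 + x) `^ p.
Proof.
move=> p1 x1 x0.
pose f z := `|z| `^ p.
have fc A : {within A, continuous f}.
  by apply: continuous_subspaceT; apply: continuous_norm_powR; lra.
have fd z : 0 < z -> is_derive z 1 f (p * z `^ (p - 1)).
  move=> z0; have := is_derive_norm_powR p (negbT (gt_eqF z0)).
  by rewrite gtr0_sg// gtr0_norm// mul1r.
have -> : (1 + x) `^ p = f (1 + x) by rewrite /f ger0_norm//; lra.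
have f1 : f 1 = 1 by rewrite /f normr1 powR1.
have [xp|xn|xe] := ltgtP x 0; last by rewrite xe eqxx in x0.
  have h : 1 + x < 1 by lra.
  have fd' z : z \in `]1 + x, 1[ -> is_derive z 1 f (p * z `^ (p - 1)).
    by rewrite in_itv/= => /andP[? ?]; apply: fd; lra.
  have [c] := MVT h fd' (fc _).
  rewrite in_itv/= => /andP[c0 c1].
  have : c `^ (p - 1) < 1 `^ (p - 1).
    by apply: gt0_ltr_powR; rewrite ?nnegrE; lra.
  rewrite powR1 f1 => hc.
  have : 0 < p * - x * (1 - c `^ (p - 1)) by rewrite !mulr_gt0//; lra.
  lra.
have h : 1 < 1 + x by lra.
have fd' z : z \in `]1, 1 + x[ -> is_derive z 1 f (p * z `^ (p - 1)).
  by rewrite in_itv/= => /andP[? ?]; apply: fd; lra.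
have [c] := MVT h fd' (fc _).
rewrite in_itv/= => /andP[c0 c1].
have : 1 `^ (p - 1) < c `^ (p - 1).
  by apply: gt0_ltr_powR; rewrite ?nnegrE; lra.
rewrite powR1 f1 => hc.
have : 0 < p * x * (c `^ (p - 1) - 1) by rewrite !mulr_gt0//; lra.
lra.
Qed.

(** At delta = 0, strict Bernoulli at 1/4 and -1/4 puts the left side above 2; from delta = 1/2 on,
    it is at most 3/4 + 1/4. The bound 1/2 removes the absolute value in the uniqueness proof and
    makes 3 - 2 delta exceed 2. *)
Lemma lp_delta_equation_bounds p delta : 1 < p ->
  lp_delta_equation p delta -> 0 < delta < 2^-1.
Proof.
move=> p1 [/andP[d0 d1] E].
have p0 : 0 < p by lra.
have d_neq0 : delta != 0.
  apply/eqP => de; move: E; rewrite de subr0.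
  have := @powR_gt_tangent p 4^-1 p1.
  have := @powR_gt_tangent p (- 4^-1) p1.
  rewrite (@ger0_norm _ (1 - 4^-1)); last lra.
  have a1 : -1 < - 4^-1 :> R by lra.
  have a2 : - 4^-1 != 0 :> R by rewrite lt_eqF//; lra.
  have a3 : -1 < 4^-1 :> R by lra.
  have a4 : 4^-1 != 0 :> R by rewrite gt_eqF//; lra.
  by move=> /(_ a1 a2) + /(_ a3 a4); lra.
rewrite lt_neqAle eq_sym d_neq0 d0/= ltNge; apply/negP => dh.
have le1 x := @ge1r_powR_le _ p x (ltW p1).
have h1 := @ge0_ler_powR _ p (ltW p0) (1 - delta + 4^-1) (3 / 4).
have h2 := @ge0_ler_powR _ p (ltW p0) `|1 - delta - 4^-1| (1 / 4).
have {}h1 : (1 - delta + 4^-1) `^ p <= (3 / 4) `^ p.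
  by apply: h1; rewrite ?nnegrE; lra.
have {}h2 : `|1 - delta - 4^-1| `^ p <= (1 / 4) `^ p.
  by apply: h2; rewrite ?nnegrE ?normr_ge0// ?ler_norml; lra.
have := le1 (3 / 4); have := le1 (1 / 4); lra.
Qed.

Lemma lp_delta_equation_unique p : 1 < p ->
  exists! delta : R, lp_delta_equation p delta.
Proof.
move=> p1; have p0 : 0 < p by lra.
have le1 x := @ge1r_powR_le _ p x (ltW p1).
pose f z := `|z - (1 + 4^-1)| `^ p + `|z - (1 - 4^-1)| `^ p.
have fE z : z <= 1 -> f z = (1 - z + 4^-1) `^ p + `|1 - z - 4^-1| `^ p.
  move=> z1; rewrite /f distrC ger0_norm; last lra.
  rewrite [`|z - (1 - _)|]distrC.
  have -> : 1 + 4^-1 - z = 1 - z + 4^-1 by ring.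
  by have -> : 1 - 4^-1 - z = 1 - z - 4^-1 by ring.
have fc : continuous f.
  by move=> z; apply: cvgD; exact: continuous_norm_powR_shift.
have f0 : 2 <= f 0.
  rewrite fE// subr0 ger0_norm; last lra.
  have h : 1 <= p by lra.
  have := @powR_midpoint_le _ p (1 + 4^-1) (1 - 4^-1) h.
  have -> : (1 + 4^-1 + (1 - 4^-1)) / 2 = 1 :> R by field.
  by rewrite powR1 mulr1; apply; lra.
have f1 : f 1 <= 2.
  rewrite fE// subrr add0r sub0r normrN ger0_norm; last lra.
  by have := le1 (4^-1); lra.
have [] := @IVT R f 0 1 2 ler01 (continuous_subspaceT fc).
  by rewrite ge_min le_max f0 f1 orbT.
move=> c; rewrite in_itv/= => c01 fce.
have ce : lp_delta_equation p c.
  by split => //; rewrite -fE// (andP c01).2.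
exists c; split => // e ee.
have [_ ch] := andP (lp_delta_equation_bounds p1 ce).
have [_ eh] := andP (lp_delta_equation_bounds p1 ee).
move: ce ee => [_ ce] [_ ee].
have mono x y : x < y -> y < 2^-1 ->
    (1 - y + 4^-1) `^ p + `|1 - y - 4^-1| `^ p <
    (1 - x + 4^-1) `^ p + `|1 - x - 4^-1| `^ p.
  clear fc f0 f1 fE; move=> xy y2; rewrite !ger0_norm; try lra.
  by apply: ltrD; apply: gt0_ltr_powR; rewrite ?nnegrE; lra.
have [lt|gt|//] := ltgtP c e.
- by have := mono _ _ lt eh; rewrite ce ee ltxx.
- by have := mono _ _ gt ch; rewrite ce ee ltxx.
Qed.

Lemma lp_deltaP p : 1 < p -> p < 2 -> lp_delta_equation p (lp_delta p).
Proof.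
move=> p1 p2; rewrite /lp_delta leNgt p2/=.
have [d [h _]] := lp_delta_equation_unique p1.
exact: (@xgetPex _ 0 [set delta | lp_delta_equation p delta] (ex_intro _ d h)).
Qed.

Lemma lp_delta_bounds p : 1 < p -> 0 < lp_delta p < 2^-1.
Proof.
move=> p1; have [p2|p2] := leP 2 p; last first.
  by apply: (lp_delta_equation_bounds p1); apply: lp_deltaP.
rewrite /lp_delta p2.
have h4 : 0 < 4 `^ (- p) :> R by apply: powR_gt0.
have h4' : 4 `^ (- p) <= 4^-1 :> R.
  by rewrite -[leRHS]powR_inv1//; apply: ler_powR; lra.
have pi0 : 0 < p^-1 by rewrite invr_gt0; lra.
have pi1 : p^-1 <= 1 by rewrite invf_le1; lra.
have : (1 - 4 `^ (- p)) `^ p^-1 < 1 `^ p^-1.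
  by apply: gt0_ltr_powR; rewrite ?nnegrE; lra.
rewrite powR1.
have : 1 - 4 `^ (- p) <= (1 - 4 `^ (- p)) `^ p^-1.
  by apply: ger1_powR => //; apply/andP; split; lra.
by move=> ? ?; apply/andP; split; lra.
Qed.

(** The single interface through which both ranges of p reach the geometry: an inequality linear in
    the p-th powers, normalized so that the pair (1 - delta_p, 1/4) gives exactly 2. *)
Lemma lp_delta_two_point p : 1 < p -> exists a b : R,
  [/\ 0 < a, 0 <= b, a * (1 - lp_delta p) `^ p + b * (4^-1) `^ p = 2 &
    forall x y, a * `|x| `^ p + b * `|y| `^ p <= `|x + y| `^ p + `|x - y| `^ p].
Proof.
move=> p1; have [p2|p2] := leP 2 p.
  exists 2, 2; split => //; last by move=> x y; exact: clarkson_scalar.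
  rewrite /lp_delta p2 subKr -powRrM mulVf ?gt_eqF; try lra.
  have h4' : 4 `^ (- p) <= 4^-1 :> R.
    by rewrite -[leRHS]powR_inv1//; apply: ler_powR; lra.
  rewrite powRr1; last lra.
  have -> : 4^-1 `^ p = 4 `^ (- p) :> R.
    by rewrite -powR_inv1// -powRrM mulN1r.
  ring.
have /andP[d0 d1] := lp_delta_bounds p1.
have [_ E] := lp_deltaP p1 p2.
move: E; set t := 1 - lp_delta p => E.
have t0 : 2^-1 < t by rewrite /t; lra.
pose r := 4^-1 / t.
have r0 : 0 < r by rewrite divr_gt0//; lra.
have r1 : r < 1 by rewrite ltr_pdivrMr; lra.
(* Hanner's inequality is sharp when the second norm is r times the first. *)
exists ((1 + r) `^ (p - 1) + (1 - r) `^ (p - 1)),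
  (((1 + r) `^ (p - 1) - (1 - r) `^ (p - 1)) / r `^ (p - 1)).
split; last by move=> x y; exact: hanner_scalar.
- by rewrite addr_gt0// powR_gt0//; lra.
- rewrite divr_ge0 ?powR_ge0// subr_ge0.
  by apply: ge0_ler_powR; rewrite ?nnegrE; lra.
rewrite -[RHS]E ger0_norm; last lra.
have pE x : 0 <= x -> x `^ p = x * x `^ (p - 1) by move=> ?; rewrite mulr_powRB1//; lra.
have t4 : 4^-1 = t * r by rewrite /r; field; lra.
clearbody r.
have -> : t + 4^-1 = t * (1 + r) by rewrite t4; ring.
have -> : t - 4^-1 = t * (1 - r) by rewrite {1}t4; ring.
rewrite t4 !powRM; try lra.
rewrite (pE r) ?(pE (1 + r)) ?(pE (1 - r)); try lra.
have : r `^ (p - 1) != 0 by rewrite gt_eqF// powR_gt0.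
by move=> ?; field.
Qed.

End Delta.

(** * Measure on tuples *)

Section SigmaFiniteMeasure.
Context d (T : measurableType d) (R : realType) (M : {measure set T -> \bar R}).
Hypothesis sfM : sigma_finite setT M.

Let m : set T -> \bar R := M.

HB.instance Definition _ := Measure.on m.
HB.instance Definition _ := Measure_isSigmaFinite.Build _ _ _ m sfM.

(** Product measures and Fubini ask for a bundled sigma-finite measure; the local copy [m] of [M]
    carries the instances that bundle a mere proof of sigma-finiteness. *)
Lemma sigma_finite_measureP :
  exists m : {sigma_finite_measure set T -> \bar R}, (m : set T -> \bar R) = M.
Proof. by exists m. Qed.

End SigmaFiniteMeasure.

Section TupleMeasure.
Context {R : realType}.
Local Open Scope ereal_scope.

Notation T n := (n.-tuple (measurableTypeR R)).
Notation lambda := (@lebesgue_measure R).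

Definition cons_tuple n (xt : measurableTypeR R * T n) : T n.+1 :=
  [tuple of xt.1 :: xt.2].

Definition uncons_tuple n (t : T n.+1) : measurableTypeR R * T n :=
  (thead t, [tuple of behead t]).

Lemma cons_tupleK n : cancel (@cons_tuple n) (@uncons_tuple n).
Proof.
by move=> [x t]; rewrite /uncons_tuple; congr (_, _); apply/val_inj.
Qed.

Lemma tnth_cons_tuple0 n xt : tnth (@cons_tuple n xt) ord0 = xt.1.
Proof. exact: tnth0. Qed.

Lemma tnth_cons_tupleS n xt i : tnth (@cons_tuple n xt) (lift ord0 i) = tnth xt.2 i.
Proof. exact: tnthS. Qed.

Lemma measurable_cons_tuple n : measurable_fun [set: _] (@cons_tuple n).
Proof. exact: (measurable_cons measurable_fst measurable_snd). Qed.

Lemma measurable_uncons_tuple n : measurable_fun [set: _] (@uncons_tuple n).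
Proof.
apply/measurable_fun_pair; first exact: measurable_tnth.
exact: measurable_behead.
Qed.

Lemma measurable_cons_tuple_preimage n (A : set (T n.+1)) :
  measurable A -> measurable (@cons_tuple n @^-1` A).
Proof.
by move=> mA; rewrite -[X in measurable X]setTI; exact: measurable_cons_tuple.
Qed.

(** [lebesgue_tuple] is a bare set function defined by recursion; all measure theory below is
    applied to this [m] and carried back along the equality. The exhausting sets are products of
    those of the factors. *)
Lemma lebesgue_tuple_sigma_finite n :
  exists m : {sigma_finite_measure set (T n) -> \bar R},
    (m : set (T n) -> \bar R) = @lebesgue_tuple R n.
Proof.
elim: n => [|n [m IHm]].
  by exists \d_[tuple].
have [M ME] : exists M : {measure set (T n.+1) -> \bar R},
    (M : set (T n.+1) -> \bar R) = pushforward (lambda \x m)%E (@cons_tuple n).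
  by exists (measure_function_pushforward__canonical__measure_function_Measure
    (lambda \x m)%E (@measurable_cons_tuple n)).
have sf : sigma_finite setT M.
  have /sigma_finiteP[F [FT Fnd Foo]] := sigma_finiteT lambda.
  have /sigma_finiteP[G [GT Gnd Goo]] := sigma_finiteT m.
  exists (fun k => (@uncons_tuple n) @^-1` (F k `*` G k)).
    apply/seteqP; split => // t _.
    have [k _ Fk] : (\bigcup_k F k) (thead t) by rewrite -FT.
    have [j _ Gj] : (\bigcup_k G k) [tuple of behead t] by rewrite -GT.
    exists (maxn k j) => //; split => /=.
      by move: Fk; exact/subsetPset/Fnd/leq_maxl.
    by move: Gj; exact/subsetPset/Gnd/leq_maxr.
  move=> k; have [mF Fk] := Foo k; have [mG Gk] := Goo k; split.
    rewrite -[X in measurable X]setTI; apply: measurable_uncons_tuple => //.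
    exact: measurableX.
  rewrite ME /pushforward -comp_preimage (_ : _ \o _ = id); last first.
    by apply/funext => xt; exact: cons_tupleK.
  by rewrite preimage_id [ltLHS]product_measure1E// lte_mul_pinfty// ge0_fin_numE.
have [mu muE] := sigma_finite_measureP sf.
by exists mu; rewrite /= muE ME -IHm.
Qed.

Lemma lebesgue_tuple_cons n (A : set (T n.+1)) :
  lebesgue_tuple A =
  \int[lambda]_x lebesgue_tuple [set t : T n | A (cons_tuple (x, t))].
Proof.
rewrite [LHS]/= /pushforward /product_measure1; apply: eq_integral => x _ /=.
by congr lebesgue_tuple; apply/seteqP; split => t; rewrite /xsection/= ?inE.
Qed.

Lemma measurable_lebesgue_tuple_cons n (A : set (T n.+1)) : measurable A ->
  measurable_fun [set: measurableTypeR R]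
    (fun x => lebesgue_tuple [set t : T n | A (cons_tuple (x, t))]).
Proof.
move=> /measurable_cons_tuple_preimage mA.
have [m mE] := lebesgue_tuple_sigma_finite n.
have := measurable_fun_xsection m mA.
congr measurable_fun; rewrite -mE.
apply/funext => x /=; congr (m _); apply/seteqP.
by split => t; rewrite /xsection/= ?inE.
Qed.

Lemma measurable_cons_tuple_section n (A : set (T n.+1)) x : measurable A ->
  measurable [set t : T n | A (cons_tuple (x, t))].
Proof.
move=> /measurable_cons_tuple_preimage mA.
rewrite (_ : mkset _ = xsection (@cons_tuple n @^-1` A) x).
  exact: measurable_xsection.
by apply/seteqP; split => t; rewrite /xsection/= ?inE.
Qed.

(** The centered interval is taken open so that membership is a strict bound on [l], as
    [lebesgue_measure_gt_diff] requires. *)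
Lemma lebesgue_measure_centered_open (l : \bar R) : 0 <= l ->
  lambda [set s | (2 * `|s|)%:E < l] = l.
Proof.
case: l => [l| |//]; rewrite ?lee_fin => l0.
  rewrite (_ : mkset _ = `](- (l / 2))%R, (l / 2)%R[%classic).
    rewrite lebesgue_measure_itv/= lte_fin.
    case: ifPn => h; first by rewrite -EFinB; congr EFin; lra.
    by congr EFin; lra.
  apply/seteqP; split => s /=; rewrite lte_fin in_itv/= -ltr_norml; lra.
rewrite (_ : mkset _ = `]-oo, +oo[%classic).
  by rewrite lebesgue_measure_itv.
by apply/seteqP; split => s //= _; exact: ltry.
Qed.

(** [B], being longer than [s], contains b and b' with b' - b >= s. If all of [A] were at distance
    less than [s] from both, it would lie between b' - s and b + s, an interval of length at most
    [s]. *)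
Lemma lebesgue_measure_gt_diff (A B : set R) (s : R) :
  measurable A -> measurable B -> (0 <= s)%R ->
  s%:E < lambda A -> s%:E < lambda B ->
  exists a b, [/\ A a, B b & (s <= `|a - b|)%R].
Proof.
move=> mA mB s0 sA sB.
apply/not_existsP => H.
have {}H a b : A a -> B b -> (`|a - b| < s)%R.
  by move=> Aa Bb; rewrite ltNge; apply/negP => h; apply: (H a); exists b.
have small (C : set R) : measurable C -> s%:E < lambda C ->
    exists c c', [/\ C c, C c' & (s <= c' - c)%R].
  move=> mC sC; apply/not_existsP => HC.
  have {}HC c c' : C c -> C c' -> (c' - c < s)%R.
    by move=> Cc Cc'; rewrite ltNge; apply/negP => h; apply: (HC c); exists c'.
  have [C0|/set0P[c0 Cc0]] := eqVneq C set0.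
    by move: sC; rewrite C0 measure0 lte_fin; lra.
  have hs : has_sup C.
    by split; [exists c0|exists (c0 + s)%R => c Cc; have := HC _ _ Cc0 Cc; lra].
  have sub : C `<=` `[(sup C - s)%R, sup C]%classic.
    move=> c Cc; rewrite /= in_itv/=; apply/andP; split; last exact: ub_le_sup hs.2 _ Cc.
    rewrite lerBlDr; apply: ge_sup; first by exists c0.
    by move=> c' Cc'; have := HC _ _ Cc Cc'; lra.
  have := le_measure lambda (mem_set mC) (mem_set (measurable_itv _)) sub.
  rewrite leNgt [X in X < _]lebesgue_measure_itv/= lte_fin; case: ifPn => _.
    by rewrite -EFinB opprB addrCA subrr addr0 sC.
  by rewrite (le_lt_trans _ sC)// lee_fin.
have [b [b' [Bb Bb' bb']]] := small _ mB sB.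
have sub : A `<=` `](b' - s)%R, (b + s)%R[%classic.
  move=> a Aa; rewrite /= in_itv/=.
  have := H a b Aa Bb; have := H a b' Aa Bb'.
  by rewrite !ltr_norml; lra.
have := le_measure lambda (mem_set mA) (mem_set (measurable_itv _)) sub.
rewrite leNgt [X in X < _]lebesgue_measure_itv/= lte_fin; case: ifPn => _.
  by rewrite (le_lt_trans _ sA)// -EFinB lee_fin; lra.
by rewrite (le_lt_trans _ sA)// lee_fin.
Qed.

Lemma measurable_sum_norm_powR p n (a : R) (c : R) :
  measurable [set t : T n | \sum_(i < n) `|a * tnth t i| `^ p <= c]%R.
Proof.
have mf : measurable_fun [set: T n] (fun t : T n => \sum_(i < n) `|a * tnth t i| `^ p)%R.
  apply: measurable_sum => i.
  apply: (measurableT_comp (measurable_powR p)).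
  apply: measurableT_comp; first exact: normr_measurable.
  apply: measurable_funM; first exact: measurable_cst.
  exact: measurable_tnth.
rewrite -[X in measurable X]setTI.
have -> : [set t : T n | \sum_(i < n) `|a * tnth t i| `^ p <= c]%R
   = (fun t : T n => \sum_(i < n) `|a * tnth t i| `^ p)%R @^-1` `]-oo, c]%classic.
  by apply/seteqP; split => t /=; rewrite in_itv.
by apply: mf => //; exact: measurable_itv.
Qed.

(* Steiner symmetrization in the first coordinate: replacing every line section
   by the centered interval of the same length keeps the measure, and its
   horizontal sections satisfy the hypothesis in one dimension less. *)
Lemma isodiametric_tuple p n (A : set (T n)) (c : R) : (0 < p)%R -> measurable A ->
  (forall s t, A s -> A t -> \sum_(i < n) `|tnth s i - tnth t i| `^ p <= c)%R ->
  lebesgue_tuple A <=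
  lebesgue_tuple [set t : T n | \sum_(i < n) `|2 * tnth t i| `^ p <= c]%R.
Proof.
move=> p0; elim: n A c => [|n IHn] A c mA diamA.
  (* The induction lowers [c] by [|2 s| ^ p], possibly below 0, so no sign is assumed; in dimension
     0 a point of [A] forces c >= 0. *)
  have [A0|/set0P[t0 At0]] := eqVneq A set0.
    by rewrite A0 [leLHS]/= dirac0 [leRHS]/= diracE lee_fin.
  rewrite [leRHS]/= diracE mem_set ?[leLHS]/= ?diracE ?lee_fin ?lern1 ?leq_b1//=.
  by have := diamA _ _ At0 At0; rewrite !big_ord0.
have [m mE] := lebesgue_tuple_sigma_finite n.
pose B := @cons_tuple n @^-1` A.
have mB : measurable B by exact: measurable_cons_tuple_preimage.
pose l t := lambda (ysection B t).
have ml : measurable_fun [set: T n] l by exact: (measurable_fun_ysection lambda mB).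
pose B' : set (measurableTypeR R * T n)%type := [set xt | (2 * `|xt.1|)%:E < l xt.2].
have mB' : measurable B'.
  rewrite -[X in measurable X]setTI.
  apply: measurable_lte; [exact: measurableT| |exact: measurableT_comp].
  apply/measurable_EFinP; apply: measurable_funM; first exact: measurable_cst.
  by apply: measurableT_comp; [exact: normr_measurable|exact: measurable_fst].
(* Both orders of integration are needed: integrating along lines shows that [B'] has the measure of
   [A], while the induction runs over the sections at a fixed first coordinate. *)
have swap (D : set (measurableTypeR R * T n)%type) : measurable D ->
    (lambda \x m) D = (lambda \x^ m) D.
  by move=> mD; apply: product_measure_unique => // ? ? ? ?; exact: product_measure2E.
have -> : lebesgue_tuple A = (lambda \x m) B' :> \bar R.
  transitivity ((lambda \x m) B); first by rewrite mE.
  rewrite !swap// /product_measure2; apply: eq_integral => t _ /=.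
  rewrite -/(l t) -[LHS]lebesgue_measure_centered_open; last exact: measure_ge0.
  congr (lambda _); apply/seteqP.
  by split => s; rewrite /ysection/= ?inE.
rewrite [leRHS]lebesgue_tuple_cons /product_measure1.
have mR := @measurable_sum_norm_powR p n.+1 2%R c.
apply: ge0_le_integral => //.
- exact: measurable_fun_xsection.
- exact: measurable_lebesgue_tuple_cons.
move=> s _ /=; rewrite mE.
have -> : [set t : T n | \sum_(i < n.+1) `|2 * tnth (cons_tuple (s, t)) i| `^ p <= c]%R
    = [set t : T n | \sum_(i < n) `|2 * tnth t i| `^ p <= c - `|2 * s| `^ p]%R.
  apply/funext => t /=; rewrite big_ord_recl tnth_cons_tuple0/= -lerBrDl.
  by under eq_bigr do rewrite tnth_cons_tupleS.
apply: IHn; first exact: measurable_xsection.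
move=> t u; rewrite /xsection /B'/= !inE/= => lt lu.
have s0 : (0 <= 2 * `|s|)%R by rewrite mulr_ge0.
(* The lines over [t] and [u] meet [A] in length more than 2|s|, hence in points a and b at least
   2|s| apart; these use up [|2 s| ^ p] of the bound [c]. *)
have [a [b [Ba Bb ab]]] := lebesgue_measure_gt_diff
  (measurable_ysection t mB) (measurable_ysection u mB) s0 lt lu.
move: Ba Bb; rewrite /ysection/= !inE /B/= => Aa Ab.
have := diamA _ _ Aa Ab; rewrite big_ord_recl !tnth_cons_tuple0/=.
under eq_bigr do rewrite !tnth_cons_tupleS.
have : (`|2 * s| `^ p <= `|a - b| `^ p)%R.
  by apply: ge0_ler_powR; rewrite ?nnegrE ?normr_ge0 ?(ltW p0)// normrM ger0_norm.
lra.
Qed.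

End TupleMeasure.

(** * Lebesgue measure under translation and dilation *)

Section TupleAffine.
Context {R : realType}.
Local Open Scope ereal_scope.

Notation T n := (n.-tuple (measurableTypeR R)).
Notation lambda := (@lebesgue_measure R).
Implicit Types (r v : R).

Let affine v r : measurableTypeR R -> measurableTypeR R := fun s => ((s - v) / r)%R.

Let measurable_affine v r : measurable_fun [set: _] (affine v r).
Proof.
apply: measurable_funM; last exact: measurable_cst.
by apply: measurable_funB; [exact: measurable_id|exact: measurable_cst].
Qed.

Lemma lebesgue_measure_affine v r (A : set (measurableTypeR R)) :
  (0 < r)%R -> measurable A ->
  lambda [set s | A ((s - v) / r)%R] = r%:E * lambda A.
Proof.
move=> r0 mA.
have ri0 : (0 <= r^-1)%R by rewrite invr_ge0 ltW.
pose M := measure_function_pushforward__canonical__measure_function_Measure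
    lambda (@measurable_affine v r).
pose mu := mscale (NngNum ri0) M.
suff -> : lambda A = mu A.
  by rewrite /mu /mscale/= muleA -EFinM divff ?gt_eqF// mul1e.
apply: lebesgue_measure_unique => // _ [[a b]] _ <-.
rewrite [RHS](_ : _ = (r^-1)%:E * lambda (affine v r @^-1` `]a, b]%classic))//.
rewrite (_ : affine v r @^-1` _ = `](a * r + v)%R, (b * r + v)%R]%classic); last first.
  apply/seteqP; split => s /=; rewrite !in_itv/= /affine ltr_pdivlMr// ler_pdivrMr//; lra.
rewrite !lebesgue_measure_itv/= !lte_fin ltrD2r ltr_pM2r//.
case: ifPn => _; last by rewrite mule0.
rewrite -EFinB -EFinM; congr EFin; field.
by rewrite gt_eqF.
Qed.

Lemma ge0_integral_affine v r (g : measurableTypeR R -> \bar R) :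
  (0 < r)%R -> measurable_fun [set: _] g -> (forall s, 0 <= g s) ->
  \int[lambda]_s g ((s - v) / r)%R = r%:E * \int[lambda]_s g s.
Proof.
move=> r0 mg g0.
transitivity (\int[pushforward lambda (affine v r)]_s g s).
  by rewrite ge0_integral_pushforward.
rewrite -(@ge0_integral_mscale _ _ _ lambda setT measurableT (NngNum (ltW r0)))//.
apply: eq_measure_integral => //= A mA _.
exact: lebesgue_measure_affine.
Qed.

Lemma lebesgue_tuple_affine n (v : T n) r (A : set (T n)) :
  (0 < r)%R -> measurable A ->
  lebesgue_tuple [set t : T n | A [tuple ((tnth t i - tnth v i) / r)%R | i < n]]
  = (r ^+ n)%:E * lebesgue_tuple A.
Proof.
move=> r0; elim: n v A => [|n IHn] v A mA.
  rewrite expr0 mul1e /=; congr (\d_ _ _).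
  by apply/funext => t /=; congr A; rewrite tuple0 [RHS]tuple0.
rewrite lebesgue_tuple_cons [in RHS]lebesgue_tuple_cons.
pose g (x : measurableTypeR R) := lebesgue_tuple [set t : T n | A (cons_tuple (x, t))].
pose w : T n := [tuple of behead v].
transitivity (\int[lambda]_x ((r ^+ n)%:E * g ((x - thead v) / r)%R)).
  apply: eq_integral => x _; rewrite /g -(IHn w); last first.
    exact: measurable_cons_tuple_section.
  congr lebesgue_tuple; apply/funext => t /=; congr A.
  apply: eq_from_tnth => i; rewrite tnth_mktuple.
  case: (unliftP ord0 i) => [j ->|->]; last by rewrite !tnth_cons_tuple0.
  rewrite !tnth_cons_tupleS tnth_mktuple tnth_behead.
  by congr ((_ - tnth v _) / _)%R; apply/val_inj; rewrite /= inordK ?ltnS.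
have mg : measurable_fun [set: measurableTypeR R] g by exact: measurable_lebesgue_tuple_cons.
have g0 s : 0 <= g s.
  by have [m mE] := @lebesgue_tuple_sigma_finite R n; rewrite /g -mE; exact: measure_ge0.
rewrite ge0_integralZl_EFin//; last 2 first.
- by apply: measurableT_comp => //; exact: measurable_affine.
- by rewrite exprn_ge0// ltW.
by rewrite ge0_integral_affine// muleA -EFinM exprSr.
Qed.

Lemma lebesgue_tuple_box n (a : R) : (0 <= a)%R ->
  measurable [set t : T n | forall i, (`|tnth t i| <= a)%R] /\
  lebesgue_tuple [set t : T n | forall i, (`|tnth t i| <= a)%R] = ((2 * a) ^+ n)%:E.
Proof.
move=> a0; elim: n => [|n [mbox IHn]].
  rewrite expr0 (_ : mkset _ = setT); last by apply/seteqP; split => // t _ [].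
  by split; [exact: measurableT|rewrite /= diracE in_setT].
set B := mkset _; set B' := mkset _ in mbox IHn.
have BE : B = @uncons_tuple R n @^-1` (`[(- a)%R, a]%classic `*` B').
  apply/seteqP; split => t /=.
    move=> Bt; split => [|i].
      by rewrite in_itv/= -ler_norml; exact: Bt.
    by rewrite tnth_behead; exact: Bt.
  move=> [t0 tS] i; case: (unliftP ord0 i) => [j ->|->].
    have := tS j; rewrite tnth_behead.
    by congr (`|tnth _ _| <= _)%R; apply/val_inj; rewrite /= inordK ?ltnS.
  by move: t0; rewrite in_itv/= -ler_norml.
have mI : measurable (`[(- a)%R, a]%classic `*` B') by exact: measurableX.
split.
  by rewrite BE -[X in measurable X]setTI; exact: measurable_uncons_tuple.
have [m mE] := @lebesgue_tuple_sigma_finite R n.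
transitivity ((lambda \x m) (`[(- a)%R, a]%classic `*` B')).
  rewrite /= /pushforward -mE; congr ((_ \x _) _).
  rewrite BE -comp_preimage (_ : _ \o _ = id)//.
  by apply/funext => xt; exact: cons_tupleK.
rewrite product_measure1E// mE IHn exprS EFinM; congr (_ * _).
rewrite [LHS]lebesgue_measure_itv/= lte_fin; case: ifPn => h.
  by rewrite -EFinB; congr EFin; lra.
by congr EFin; lra.
Qed.

End TupleAffine.

(** * The l^p norm and volume *)

HB.lock Definition lpnorm {R : realType} (p : R) (d : nat) (x : 'rV[R]_d) : R :=
  (\sum_(j < d) `|x ord0 j| `^ p) `^ p^-1.

Arguments lpnorm {R} p {d} x.

Section LpNorm.
Context {R : realType} (p : R) (d : nat).
Hypothesis p1 : 1 < p.
Implicit Types (x y z a u : 'rV[R]_d) (c r : R).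

Local Notation lpnorm := (lpnorm p).

Let p0 : 0 < p. Proof. by rewrite (lt_trans ltr01). Qed.

Let sum_ge0 x : 0 <= \sum_(j < d) `|x ord0 j| `^ p.
Proof. by apply: sumr_ge0 => j _; exact: powR_ge0. Qed.

Lemma lpnorm_ge0 x : 0 <= lpnorm x.
Proof. by rewrite lpnorm.unlock powR_ge0. Qed.

Lemma lpnorm_powR x : lpnorm x `^ p = \sum_(j < d) `|x ord0 j| `^ p.
Proof. by rewrite lpnorm.unlock -powRrM mulVf ?gt_eqF// powRr1. Qed.

Lemma lpnorm_le x c : 0 <= c ->
  (lpnorm x <= c) = (\sum_(j < d) `|x ord0 j| `^ p <= c `^ p).
Proof.
move=> c0; rewrite -lpnorm_powR; apply/idP/idP => [h|].
  by apply: ge0_ler_powR; rewrite ?nnegrE ?lpnorm_ge0// ltW.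
rewrite leNgt => /negP h; rewrite leNgt; apply/negP => h'; apply: h.
by apply: gt0_ltr_powR; rewrite ?nnegrE ?lpnorm_ge0.
Qed.

Lemma lp_ballE : lp_ball d p = [set x | lpnorm x <= 1].
Proof. by apply/funext => x; rewrite /lp_ball/= lpnorm_le// powR1. Qed.

Lemma lpnormZ c x : lpnorm (c *: x) = `|c| * lpnorm x.
Proof.
rewrite lpnorm.unlock.
under eq_bigr do rewrite mxE normrM powRM//.
rewrite -mulr_sumr powRM ?powR_ge0//.
by rewrite -powRrM mulfV ?gt_eqF// powRr1.
Qed.

Lemma lpnorm0 : lpnorm (0 : 'rV[R]_d) = 0.
Proof. by rewrite -(scale0r (0 : 'rV[R]_d)) lpnormZ normr0 mul0r. Qed.

Lemma lpnormN x : lpnorm (- x) = lpnorm x.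
Proof. by rewrite -scaleN1r lpnormZ normrN1 mul1r. Qed.

Lemma lpnormB x y : lpnorm (x - y) = lpnorm (y - x).
Proof. by rewrite -lpnormN opprB. Qed.

Lemma lpnorm_convex t x y : 0 <= t <= 1 -> lpnorm x <= 1 -> lpnorm y <= 1 ->
  lpnorm (t *: x + (1 - t) *: y) <= 1.
Proof.
move=> t01; have /andP[t0 t1] := t01.
rewrite (lpnorm_le x ler01) (lpnorm_le y ler01) (lpnorm_le _ ler01) powR1 => x1 y1.
apply: (@le_trans _ _ (t * (\sum_(j < d) `|x ord0 j| `^ p)
   + (1 - t) * \sum_(j < d) `|y ord0 j| `^ p)); last first.
  have h : 0 <= 1 - t by rewrite subr_ge0.
  by have := ler_wpM2l t0 x1; have := ler_wpM2l h y1; lra.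
rewrite !mulr_sumr -big_split/=; apply: ler_sum => j _.
apply: le_trans (powR_convex (ltW p1) t01 (normr_ge0 _) (normr_ge0 _)).
apply: ge0_ler_powR; rewrite ?nnegrE ?(ltW p0)//.
  by rewrite addr_ge0// mulr_ge0// subr_ge0.
rewrite !mxE (le_trans (ler_normD _ _))// !normrM.
by rewrite (ger0_norm t0) (@ger0_norm _ (1 - t)) ?subr_ge0.
Qed.

(** Minkowski's inequality from convexity of the unit ball: (x + y)/(a + b) is the convex
    combination of x/a and y/b with weight a/(a + b). The slack e/2 keeps a and b positive when a
    norm vanishes. *)
Lemma lpnorm_triangle x y : lpnorm (x + y) <= lpnorm x + lpnorm y.
Proof.
apply/ler_addgt0Pr => e e0.
have [a0 b0] : 0 < lpnorm x + e / 2 /\ 0 < lpnorm y + e / 2.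
  by have := lpnorm_ge0 x; have := lpnorm_ge0 y; split; lra.
have E : lpnorm x + lpnorm y + e = (lpnorm x + e / 2) + (lpnorm y + e / 2) by field.
have ax : lpnorm x <= lpnorm x + e / 2 by lra.
have by_ : lpnorm y <= lpnorm y + e / 2 by lra.
rewrite E; move: (lpnorm x + e / 2) (lpnorm y + e / 2) a0 b0 ax by_ => a b a0 b0 ax by_.
have ab0 : 0 < a + b by rewrite addr_gt0.
have := @lpnorm_convex (a / (a + b)) (a^-1 *: x) (b^-1 *: y).
rewrite (lpnormZ _ x) (lpnormZ _ y) (@ger0_norm _ a^-1) ?invr_ge0 ?(ltW a0)//.
rewrite (@ger0_norm _ b^-1) ?invr_ge0 ?(ltW b0)// (ler_pdivrMl _ _ a0) (ler_pdivrMl _ _ b0) !mulr1.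
move=> /(_ _ ax by_).
have -> : a / (a + b) *: (a^-1 *: x) + (1 - a / (a + b)) *: (b^-1 *: y)
   = (a + b)^-1 *: (x + y).
  rewrite !scalerA scalerDr; congr (_ *: _ + _ *: _); field.
    by rewrite !gt_eqF.
  by rewrite !gt_eqF.
rewrite lpnormZ ger0_norm ?invr_ge0 ?(ltW ab0)// (ler_pdivrMl _ _ ab0) mulr1; apply.
by rewrite divr_ge0 ?(ltW a0) ?(ltW ab0)//= (ler_pdivrMr _ _ ab0) mul1r lerDl ltW.
Qed.

(** The two-point inequality is summed over the coordinates of the half-sum and half-difference. The
    right side is at most 2 and the difference term at least [be * 4^-1 ^ p], which leaves precisely
    (1 - delta_p)^p for the half-sum. *)
Lemma lpnorm_uniform_convex a u : lpnorm a <= 1 -> lpnorm u <= 1 ->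
  2^-1 <= lpnorm (a - u) -> lpnorm (a + u) <= 2 * (1 - lp_delta p).
Proof.
move=> a1 u1 au.
have /andP[d0 d1] := lp_delta_bounds p1.
have [al [be [al0 be0 E H]]] := lp_delta_two_point p1.
set D := lp_delta p in d0 d1 E *.
suff : lpnorm (2^-1 *: (a + u)) <= 1 - D.
  by rewrite lpnormZ ger0_norm ?invr_ge0// ler_pdivrMl.
have D1 : 0 <= 1 - D by lra.
rewrite lpnorm_le// -(ler_pM2l al0).
move: a1 u1; rewrite (lpnorm_le a ler01) (lpnorm_le u ler01) powR1 => a1 u1.
have g4 : 4^-1 `^ p <= \sum_(j < d) `|(2^-1 *: (a - u)) ord0 j| `^ p.
  rewrite -lpnorm_powR; apply: ge0_ler_powR; rewrite ?nnegrE ?lpnorm_ge0 ?(ltW p0)//.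
  by rewrite lpnormZ ger0_norm ?invr_ge0//; lra.
have : al * (\sum_(j < d) `|(2^-1 *: (a + u)) ord0 j| `^ p)
   + be * (\sum_(j < d) `|(2^-1 *: (a - u)) ord0 j| `^ p)
   <= \sum_(j < d) `|a ord0 j| `^ p + \sum_(j < d) `|u ord0 j| `^ p.
  rewrite !mulr_sumr -!big_split/=; apply: ler_sum => j _.
  apply: le_trans (H _ _) _; rewrite !mxE.
  have -> : 2^-1 * (a ord0 j + u ord0 j) + 2^-1 * (a ord0 j - u ord0 j) = a ord0 j by field.
  by have -> : 2^-1 * (a ord0 j + u ord0 j) - 2^-1 * (a ord0 j - u ord0 j) = u ord0 j by field.
have := ler_wpM2l be0 g4.
lra.
Qed.

End LpNorm.

Section Volume.
Context {R : realType} {d : nat}.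
Local Open Scope ereal_scope.
Implicit Types (E F : set 'rV[R]_d).

Notation T := (d.-tuple (measurableTypeR R)).

Definition vmeasurable E : Prop :=
  measurable [set t : T | E (\row_(i < d) tnth t i)].

Let volume_measure : exists m : {measure set T -> \bar R},
  forall E, volume E = m [set t : T | E (\row_(i < d) tnth t i)].
Proof. by have [m mE] := @lebesgue_tuple_sigma_finite R d; exists m => E; rewrite mE. Qed.

Lemma volume_ge0 E : 0 <= volume E.
Proof. by have [m ->] := volume_measure; exact: measure_ge0. Qed.

Lemma volume_set0 : volume (set0 : set 'rV[R]_d) = 0.
Proof. by have [m ->] := volume_measure; exact: measure0. Qed.

Lemma le_volume E F : vmeasurable E -> vmeasurable F -> E `<=` F ->
  volume E <= volume F.
Proof.
have [m mE] := volume_measure; move=> ? ? EF; rewrite !mE.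
by apply: le_measure; rewrite ?inE// => t /EF.
Qed.

Lemma vmeasurableU E F : vmeasurable E -> vmeasurable F -> vmeasurable (E `|` F).
Proof. exact: measurableU. Qed.

Lemma volumeU_le E F : vmeasurable E -> vmeasurable F ->
  volume (E `|` F) <= volume E + volume F.
Proof.
by have [m mE] := volume_measure; move=> ? ?; rewrite !mE; exact: measureU2.
Qed.

Let set_cons (I : eqType) (i : I) (s : seq I) : [set` i :: s] = i |` [set` s].
Proof.
apply/seteqP; split => j /=; rewrite in_cons.
  by move=> /orP[/eqP ->|]; [left|right].
by move=> [->|->]; rewrite ?eqxx ?orbT.
Qed.

Let set_nil (I : eqType) : [set` [::] : seq I] = set0.
Proof. by apply/seteqP; split => j //=; rewrite in_nil. Qed.

Lemma vmeasurable_bigcup_seq (I : eqType) (s : seq I) (F : I -> set 'rV[R]_d) :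
  (forall i, i \in s -> vmeasurable (F i)) ->
  vmeasurable (\bigcup_(i in [set` s]) F i).
Proof.
elim: s => [|i s IHs] mF.
  rewrite set_nil bigcup_set0; exact: measurable0.
rewrite set_cons bigcup_setU1.
apply: vmeasurableU; first by apply: mF; rewrite mem_head.
by apply: IHs => j js; apply: mF; rewrite in_cons js orbT.
Qed.

Lemma volume_bigcup_seq_le (I : eqType) (s : seq I) (F : I -> set 'rV[R]_d) :
  (forall i, i \in s -> vmeasurable (F i)) ->
  volume (\bigcup_(i in [set` s]) F i) <= \sum_(i <- s) volume (F i).
Proof.
elim: s => [|i s IHs] mF.
  by rewrite set_nil bigcup_set0 big_nil volume_set0.
rewrite set_cons bigcup_setU1 big_cons.
have mi : vmeasurable (F i) by apply: mF; rewrite mem_head.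
have ms j : j \in s -> vmeasurable (F j) by move=> js; apply: mF; rewrite in_cons js orbT.
apply: le_trans (leeD2l _ (IHs ms)).
exact: volumeU_le mi (vmeasurable_bigcup_seq ms).
Qed.

Lemma volume_bigcup_seq (I : eqType) (s : seq I) (F : I -> set 'rV[R]_d) :
  uniq s -> (forall i, i \in s -> vmeasurable (F i)) ->
  (forall i j, i \in s -> j \in s -> i != j -> F i `&` F j = set0) ->
  volume (\bigcup_(i in [set` s]) F i) = \sum_(i <- s) volume (F i).
Proof.
elim: s => [|i s IHs] us mF tF.
  by rewrite set_nil bigcup_set0 big_nil volume_set0.
rewrite set_cons bigcup_setU1 big_cons.
move: us; rewrite cons_uniq => /andP[nis us].
have mi : vmeasurable (F i) by apply: mF; rewrite mem_head.
have ms j : j \in s -> vmeasurable (F j) by move=> js; apply: mF; rewrite in_cons js orbT.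
rewrite -IHs//; last first.
  by move=> j k js ks; apply: tF; rewrite in_cons ?js ?ks orbT.
have [m mE] := volume_measure; rewrite !mE.
apply: (@measureU _ _ _ m _ _ mi (vmeasurable_bigcup_seq ms)).
apply/seteqP; split => // t [/= Fi [j js Fj]].
have : (F i `&` F j) (\row_(i < d) tnth t i) by [].
rewrite tF// ?mem_head// ?in_cons ?js ?orbT//.
by apply: contraNneq nis => ->.
Qed.

Lemma vmeasurable_bigcup (I : finType) (S : {set I}) (F : I -> set 'rV[R]_d) :
  (forall i, i \in S -> vmeasurable (F i)) -> vmeasurable (\bigcup_(i in [set` S]) F i).
Proof.
move=> mF; rewrite (_ : [set` S] = [set` enum S]).
  by apply: vmeasurable_bigcup_seq => i; rewrite mem_enum; exact: mF.
by apply/seteqP; split => i /=; rewrite mem_enum.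
Qed.

Lemma volume_bigcup_le (I : finType) (S : {set I}) (F : I -> set 'rV[R]_d) :
  (forall i, i \in S -> vmeasurable (F i)) ->
  volume (\bigcup_(i in [set` S]) F i) <= \sum_(i in S) volume (F i).
Proof.
move=> mF; rewrite -big_enum (_ : [set` S] = [set` enum S]).
  by apply: volume_bigcup_seq_le => i; rewrite mem_enum; exact: mF.
by apply/seteqP; split => i /=; rewrite mem_enum.
Qed.

Lemma volume_bigcup (I : finType) (S : {set I}) (F : I -> set 'rV[R]_d) :
  (forall i, i \in S -> vmeasurable (F i)) ->
  (forall i j, i \in S -> j \in S -> i != j -> F i `&` F j = set0) ->
  volume (\bigcup_(i in [set` S]) F i) = \sum_(i in S) volume (F i).
Proof.
move=> mF tF; rewrite -big_enum (_ : [set` S] = [set` enum S]).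
  apply: volume_bigcup_seq => [|i|i j]; rewrite ?enum_uniq ?mem_enum//.
    exact: mF.
  exact: tF.
by apply/seteqP; split => i /=; rewrite mem_enum.
Qed.

Lemma volume_affine (v : 'rV[R]_d) (r : R) E : (0 < r)%R -> vmeasurable E ->
  volume [set x | E (r^-1 *: (x - v))%R] = (r ^+ d)%:E * volume E.
Proof.
move=> r0 mE; rewrite /volume -(lebesgue_tuple_affine [tuple v ord0 i | i < d] r0 mE).
congr lebesgue_tuple; apply/funext => t /=; congr E.
by apply/rowP => i; rewrite !mxE !tnth_mktuple mulrC.
Qed.

End Volume.

(** * Volume of l^p balls and the isodiametric inequality *)

Section LpBall.
Context {R : realType} (p : R) (d : nat).
Hypothesis p1 : 1 < p.
Implicit Types (v x : 'rV[R]_d) (r : R).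

Let p0 : 0 < p. Proof. by rewrite (lt_trans ltr01). Qed.

Definition lpball v r : set 'rV[R]_d := [set x | lpnorm p (x - v) <= r].

Lemma lpball_homothetic v r : 0 < r ->
  [set v + r *: x | x in lp_ball d p] = lpball v r.
Proof.
move=> r0; rewrite (lp_ballE _ p1); apply/seteqP; split => x /=.
  move=> [y /= y1 <-]; rewrite /lpball/= addrAC subrr add0r (lpnormZ p1).
  by rewrite gtr0_norm// ler_piMr// ltW.
rewrite /lpball/= => xr; exists (r^-1 *: (x - v)).
  by rewrite /= (lpnormZ p1) gtr0_norm ?invr_gt0// ler_pdivrMl// mulr1.
by rewrite scalerA divff ?gt_eqF// scale1r subrKC.
Qed.

Lemma lpballE v r : 0 < r -> lpball v r = [set x | lp_ball d p (r^-1 *: (x - v))].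
Proof.
move=> r0; apply/funext => x; rewrite (lp_ballE _ p1) /lpball/= (lpnormZ p1).
by rewrite gtr0_norm ?invr_gt0// ler_pdivrMl// mulr1.
Qed.

Lemma vmeasurable_lp_ball : vmeasurable (lp_ball (R := R) d p).
Proof.
have := @measurable_sum_norm_powR R p d 1 1.
congr measurable; apply/funext => t /=; congr (_ <= _).
by under [RHS]eq_bigr do rewrite mxE -[tnth _ _]mul1r.
Qed.

Lemma vmeasurable_lpball v r : 0 <= r -> vmeasurable (lpball v r).
Proof.
move=> r0.
have mf : measurable_fun [set: d.-tuple (measurableTypeR R)]
    (fun t : d.-tuple (measurableTypeR R) => \sum_(i < d) `|tnth t i - v ord0 i| `^ p).
  apply: measurable_sum => i.
  apply: (measurableT_comp (measurable_powR p)).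
  apply: measurableT_comp; first exact: normr_measurable.
  apply: measurable_funB; last exact: measurable_cst.
  exact: measurable_tnth.
rewrite /vmeasurable -[X in measurable X]setTI.
have -> : [set t : d.-tuple (measurableTypeR R) | lpball v r (\row_(i < d) tnth t i)]
   = (fun t : d.-tuple (measurableTypeR R) => \sum_(i < d) `|tnth t i - v ord0 i| `^ p)
     @^-1` `]-oo, (r `^ p)]%classic.
  apply/funext => t /=; rewrite in_itv/= /lpball/= (lpnorm_le p1)//; congr (_ <= _).
  by apply: eq_bigr => i _; rewrite !mxE.
by apply: mf => //; exact: measurable_itv.
Qed.

(** The ball lies between the cubes of half-sides 1/(d + 1) and 1; using d + 1 instead of d avoids
    an exception in dimension 0. *)
Lemma volume_lp_ball_fin_pos : exists2 k : R, 0 < k & volume (lp_ball (R := R) d p) = k%:E.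
Proof.
have [m mE] := @lebesgue_tuple_sigma_finite R d.
pose box a := [set t : d.-tuple (measurableTypeR R) | forall i, `|tnth t i| <= a].
have i0 : 0 < (d.+1%:R : R)^-1 by rewrite invr_gt0.
have [mb1 vb1] := @lebesgue_tuple_box R d 1 ler01.
have [mb vb] := @lebesgue_tuple_box R d _ (ltW i0).
have up : (volume (lp_ball (R := R) d p) <= ((2 * 1) ^+ d)%:E)%E.
  rewrite -vb1 /volume -mE; apply: le_measure; rewrite ?inE//; first exact: vmeasurable_lp_ball.
  move=> t /= h i; rewrite leNgt; apply/negP => ti.
  move: h; rewrite /lp_ball/= leNgt => /negP; apply.
  rewrite (bigD1 i)//= mxE ltr_wpDr//.
    by apply: sumr_ge0 => j _; exact: powR_ge0.
  by have := gt0_ltr_powR p0 _ _ ti; rewrite powR1; apply; rewrite nnegrE.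
have lo : (((2 * d.+1%:R^-1) ^+ d)%:E <= volume (lp_ball (R := R) d p))%E.
  rewrite -vb /volume -mE; apply: le_measure; rewrite ?inE//; first exact: vmeasurable_lp_ball.
  move=> t /= h; rewrite /lp_ball/=.
  apply: (@le_trans _ _ (\sum_(j < d) d.+1%:R^-1)).
    apply: ler_sum => j _; rewrite mxE.
    have [->|tj] := eqVneq (tnth t j) 0; first by rewrite normr0 powR0 ?gt_eqF// ltW.
    apply: le_trans (h j); rewrite ge1r_powR ?(ltW p1)// normr_gt0 tj/=.
    by rewrite (le_trans (h j))// invf_le1// ler1n.
  by rewrite sumr_const card_ord -[X in X <= _]mulr_natr mulrC ler_pdivrMr// mul1r ler_nat.
have : volume (lp_ball (R := R) d p) \is a fin_num.
  by rewrite ge0_fin_numE ?volume_ge0// (le_lt_trans up)// ltry.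
move=> /fineK E; exists (fine (volume (lp_ball (R := R) d p))); last by rewrite E.
rewrite -lte_fin E (lt_le_trans _ lo)// lte_fin exprn_gt0// mulr_gt0.
Qed.

Lemma volume_lpball v r : 0 < r ->
  volume (lpball v r) = ((r ^+ d)%:E * volume (lp_ball (R := R) d p))%E.
Proof.
by move=> r0; rewrite lpballE// volume_affine//; exact: vmeasurable_lp_ball.
Qed.

Lemma isodiametric (E : set 'rV[R]_d) r : 0 < r -> vmeasurable E ->
  (forall x y, E x -> E y -> lpnorm p (x - y) <= 2 * r) ->
  (volume E <= (r ^+ d)%:E * volume (lp_ball (R := R) d p))%E.
Proof.
move=> r0 mE dE.
have := @isodiametric_tuple R p d [set t | E (\row_(i < d) tnth t i)] ((2 * r) `^ p) p0 mE.
rewrite -(volume_lpball 0 r0).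
have r20 : 0 <= 2 * r by rewrite mulr_ge0// ltW.
have -> : volume (lpball 0 r) = lebesgue_tuple
    [set t : d.-tuple (measurableTypeR R) | \sum_(i < d) `|2 * tnth t i| `^ p <= (2 * r) `^ p].
  rewrite /volume; congr lebesgue_tuple; apply/funext => t /=.
  rewrite /lpball/= (lpnorm_le p1) ?(ltW r0)// powRM ?(ltW r0)//.
  under [in RHS]eq_bigr do rewrite normrM powRM// gtr0_norm//.
  rewrite -mulr_sumr ler_pM2l ?powR_gt0//; congr (_ <= _).
  by apply: eq_bigr => i _; rewrite !mxE subr0.
apply=> s t Es Et; have := dE _ _ Es Et; rewrite (lpnorm_le p1)//.
by congr (_ <= _); apply: eq_bigr => i _; rewrite !mxE.
Qed.

End LpBall.

(** * Disjoint subfamilies *)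

Section TranslatePacking.
Context {R : realType} (p : R) (d : nat).
Hypothesis p1 : 1 < p.
Variables (I : finType) (c : I -> 'rV[R]_d) (r : R).
Hypothesis r0 : 0 < r.
Implicit Types (A S : {set I}).

Local Notation nrm := (lpnorm p).

(** Boolean, so that a largest such set can be chosen among finitely many; strict, because closed
    balls whose centers are exactly 2r apart still touch. *)
Definition separated_centers S : bool :=
  [forall i in S, forall j in S, (i != j) ==> (2 * r < nrm (c i - c j))].

Lemma separated_centersP S :
  reflect (forall i j, i \in S -> j \in S -> i != j -> 2 * r < nrm (c i - c j))
          (separated_centers S).
Proof.
apply: (iffP idP) => [h i j iS jS ij|h].
  by move/forall_inP : h => /(_ _ iS)/forall_inP/(_ _ jS)/implyP; exact.
by apply/forall_inP => i iS; apply/forall_inP => j jS; apply/implyP; exact: h.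
Qed.

Let nrm_self i : nrm (c i - c i) <= 2 * r.
Proof. by rewrite subrr (lpnorm0 _ p1) mulr_ge0// ltW. Qed.

Lemma separated_centersU1 S w : separated_centers S ->
  (forall j, j \in S -> 2 * r < nrm (c w - c j)) -> separated_centers (w |: S).
Proof.
move=> /separated_centersP hS hw; apply/separated_centersP => i j.
rewrite !in_setU1 => /orP[/eqP->|iS] /orP[/eqP->|jS].
- by rewrite eqxx.
- by move=> _; exact: hw.
- by move=> _; rewrite (lpnormB p1); exact: hw.
- exact: hS.
Qed.

Lemma separated_centersS S S' : S' \subset S -> separated_centers S -> separated_centers S'.
Proof.
move=> /fintype.subsetP sS /separated_centersP hS; apply/separated_centersP => i j iS jS.
by apply: hS; exact: sS.
Qed.

Section MaximumPacking.
Variables (A S : {set I}).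
Hypotheses (SA : S \subset A) (sepS : separated_centers S).
Hypothesis maxS : forall S', S' \subset A -> separated_centers S' -> (#|S'| <= #|S|)%N.

Lemma maximum_packing_meets w : w \in A -> exists2 v, v \in S & nrm (c w - c v) <= 2 * r.
Proof.
move=> wA; apply: contrapT => H.
have {}H v : v \in S -> 2 * r < nrm (c w - c v).
  by move=> vS; rewrite ltNge; apply/negP => h; apply: H; exists v.
have wS : w \notin S by apply/negP => /H; rewrite ltNge nrm_self.
have sub : w |: S \subset A by rewrite finset.subUset finset.sub1set wA.
by have := maxS sub (separated_centersU1 sepS H); rewrite cardsU1 wS ltnn.
Qed.

Definition sole_neighbours v : {set I} :=
  [set w in A | [forall (v' | v' \in S), (nrm (c w - c v') <= 2 * r) == (v' == v)]].

Lemma sole_neighboursP v w : w \in sole_neighbours v ->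
  w \in A /\ forall v', v' \in S -> (nrm (c w - c v') <= 2 * r) = (v' == v).
Proof. by rewrite inE => /andP[wA /forall_inP h]; split=> // v' /h/eqP. Qed.

(* Otherwise exchanging v for w and w' would give a larger packing. *)
Lemma sole_neighbours_close v w w' : v \in S ->
  w \in sole_neighbours v -> w' \in sole_neighbours v -> nrm (c w - c w') <= 2 * r.
Proof.
move=> vS /sole_neighboursP[wA hw] /sole_neighboursP[wA' hw'].
rewrite leNgt; apply/negP => ww'.
have far u : (forall v', v' \in S -> (nrm (c u - c v') <= 2 * r) = (v' == v)) ->
    forall j, j \in S :\ v -> 2 * r < nrm (c u - c j).
  by move=> hu j; rewrite !inE => /andP[jv jS]; rewrite ltNge hu.
have notin u : (forall v', v' \in S -> (nrm (c u - c v') <= 2 * r) = (v' == v)) ->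
    u \notin S :\ v.
  by move=> hu; apply/negP => /(far _ hu); rewrite ltNge nrm_self.
have sep' : separated_centers (w' |: S :\ v).
  apply: separated_centersU1; last exact: far.
  exact: separated_centersS (finset.subsetDl _ _) sepS.
have sep : separated_centers (w |: (w' |: S :\ v)).
  apply: separated_centersU1 => // j; rewrite in_setU1 => /orP[/eqP->//|].
  exact: far.
have sub : w |: (w' |: S :\ v) \subset A.
  rewrite !finset.subUset !finset.sub1set wA wA'/=.
  exact: fintype.subset_trans (finset.subsetDl _ _) SA.
have := maxS sub sep.
rewrite !cardsU1 notin// in_setU1 negb_or notin// andbT.
have -> : w != w' by apply: contraTneq ww' => ->; rewrite -leNgt nrm_self.
by rewrite (cardsD1 v S) vS/= !add1n ltnn.
Qed.

(* If x lies in the ball of w but far from the centers of S, uniform convexity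
   forces every v in S whose ball meets that of w to be close to
   c w - 2 (x - c w); by separation there is only one such v. *)
Lemma maximum_packing_cover w x : w \in A -> lpball p (c w) r x ->
  (exists2 v, v \in S & lpball p (c v) ((3 - 2 * lp_delta p) * r) x) \/
  (exists2 v, v \in S & w \in sole_neighbours v).
Proof.
move=> wA xw; have [|H] := pselect (exists2 v, v \in S &
  lpball p (c v) ((3 - 2 * lp_delta p) * r) x); [by left|right].
have close v : v \in S -> nrm (c w - c v) <= 2 * r ->
    nrm ((c w - c v) - 2 *: (x - c w)) < r.
  move=> vS wv; rewrite ltNge; apply/negP => h; apply: H; exists v => //.
  pose a := (2 * r)^-1 *: (c w - c v); pose u := r^-1 *: (x - c w).
  have r20 : 0 < 2 * r by rewrite mulr_gt0.
  have rn0 : r != 0 by rewrite gt_eqF.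
  have a1 : nrm a <= 1.
    by rewrite (lpnormZ p1) gtr0_norm ?invr_gt0// (ler_pdivrMl _ _ r20) mulr1.
  have u1 : nrm u <= 1.
    by rewrite (lpnormZ p1) gtr0_norm ?invr_gt0// (ler_pdivrMl _ _ r0) mulr1.
  have au : 2^-1 <= nrm (a - u).
    have -> : a - u = (2 * r)^-1 *: ((c w - c v) - 2 *: (x - c w)).
      by apply/rowP => j; rewrite !mxE; field.
    rewrite (lpnormZ p1) gtr0_norm ?invr_gt0// (ler_pdivlMl _ _ r20).
    by rewrite mulrAC divff// mul1r.
  have := lpnorm_uniform_convex p1 a1 u1 au.
  have -> : lpball p (c v) ((3 - 2 * lp_delta p) * r) x =
    (nrm (x - c v) <= (3 - 2 * lp_delta p) * r) :> Prop by [].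
  have -> : x - c v = r *: (a + (a + u)).
    by apply/rowP => j; rewrite !mxE; field.
  rewrite (lpnormZ p1) (gtr0_norm r0) [r * _]mulrC (ler_pM2r r0) => h2.
  apply: (le_trans (lpnorm_triangle p1 _ _)); lra.
have [v vS wv] := maximum_packing_meets wA.
exists v => //; rewrite inE wA/=; apply/forall_inP => v' v'S; apply/eqP.
have [->|v'v] := eqVneq v' v; first exact: wv.
apply/negP => wv'.
have := separated_centersP _ sepS _ _ v'S vS v'v; rewrite ltNge => /negP; apply.
have -> : c v' - c v = ((c w - c v) - 2 *: (x - c w)) - ((c w - c v') - 2 *: (x - c w)).
  by rewrite opprB addrA subrK opprB addrC addrA subrK.
apply: (le_trans (lpnorm_triangle p1 _ _)); rewrite (lpnormN p1).
have := close _ vS wv; have := close _ v'S wv'; lra.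
Qed.

End MaximumPacking.

Lemma translate_packing A : exists S,
  [/\ S \subset A,
      forall i j, i \in S -> j \in S -> i != j -> 2 * r < nrm (c i - c j) &
      (volume (\bigcup_(i in [set` A]) lpball p (c i) r) <=
       (#|S|%:R * ((2 ^+ d + (3 - 2 * lp_delta p) ^+ d) * r ^+ d))%:E *
       volume (lp_ball (R := R) d p))%E].
Proof.
pose P S := (S \subset A) && separated_centers S.
have P0 : P finset.set0.
  by rewrite /P finset.sub0set; apply/separated_centersP => i j; rewrite inE.
case: (arg_maxnP (fun S => #|S|) P0) => S /andP[SA sepS] maxP.
have maxS S' : S' \subset A -> separated_centers S' -> (#|S'| <= #|S|)%N.
  by move=> h1 h2; apply: maxP; rewrite /P h1.
exists S; split => //; first exact/separated_centersP.
have /andP[d0 d1] := lp_delta_bounds p1.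
set b := 3 - 2 * lp_delta p.
have b0 : 0 < b by rewrite /b; lra.
have br0 : 0 < b * r by rewrite mulr_gt0.
pose D v := \bigcup_(w in [set` sole_neighbours A S v]) lpball p (c w) r.
have mD v : vmeasurable (D v).
  by apply: vmeasurable_bigcup => i _; apply: vmeasurable_lpball => //; exact: ltW.
have mb v : vmeasurable (lpball p (c v) (b * r)).
  by apply: vmeasurable_lpball => //; exact: ltW.
(* Everything charged to [v]: its dilated ball accounts for the term b^d, the balls meeting no other
   selected ball for 2^d. *)
pose E v := lpball p (c v) (b * r) `|` D v.
have mE v : vmeasurable (E v) by exact: vmeasurableU.
have sub : \bigcup_(i in [set` A]) lpball p (c i) r `<=` \bigcup_(v in [set` S]) E v.
  move=> x [w /= wA xw].
  have [[v vS xv]|[v vS wv]] := maximum_packing_cover SA sepS maxS wA xw.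
    by exists v => //; left.
  by exists v => //; right; exists w.
have mA : vmeasurable (\bigcup_(i in [set` A]) lpball p (c i) r).
  by apply: vmeasurable_bigcup => i _; apply: vmeasurable_lpball => //; exact: ltW.
have mS : vmeasurable (\bigcup_(v in [set` S]) E v).
  by apply: vmeasurable_bigcup => i _.
apply: (le_trans (le_volume mA mS sub)).
apply: (le_trans (volume_bigcup_le (fun i _ => mE i))).
have [k k0 kE] := volume_lp_ball_fin_pos d p1.
have vD v : v \in S -> (volume (D v) <= ((2 * r) ^+ d)%:E * volume (lp_ball (R := R) d p))%E.
  move=> vS; apply: isodiametric => //; first by rewrite mulr_gt0.
  move=> x y [w /= wv xw] [w' /= wv' yw'].
  have ww' := sole_neighbours_close SA sepS maxS vS wv wv'.
  have -> : x - y = (x - c w) + ((c w - c w') - (y - c w')).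
    by rewrite addrA addrA subrK opprB addrA subrK.
  apply: le_trans (lpnorm_triangle p1 _ _) _.
  have := lpnorm_triangle p1 (c w - c w') (- (y - c w')).
  rewrite (lpnormN p1); move: xw yw'; rewrite /lpball/=; lra.
apply: (@le_trans _ _ (\sum_(v in S) (((2 ^+ d + b ^+ d) * r ^+ d * k)%:E))%E).
  apply: lee_sum => v vS.
  apply: (@le_trans _ _ (volume (lpball p (c v) (b * r)) + volume (D v))%E).
    exact: volumeU_le.
  apply: (le_trans (leeD2l _ (vD _ vS))).
  rewrite volume_lpball// kE -!EFinM -EFinD lee_fin !exprMn; lra.
by rewrite sumEFin sumr_const kE -EFinM lee_fin -[X in X <= _]mulr_natl !mulrA.
Qed.

End TranslatePacking.

(** * Selection among balls of different radii *)

Section HomothetPacking.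
Context {R : realType} (p : R) (d : nat).
Hypothesis p1 : 1 < p.
Variables (I : finType) (c : I -> 'rV[R]_d) (rad : I -> R).
Hypothesis rad0 : forall i, 0 < rad i.
Implicit Types (A S : {set I}) (q eta : R).

Local Notation nrm := (lpnorm p).
Local Notation M := (2 ^+ d + (3 - 2 * lp_delta p) ^+ d).
Local Notation kappa := (volume (lp_ball (R := R) d p)).

Let mball i : vmeasurable (lpball p (c i) (rad i)).
Proof. by apply: vmeasurable_lpball => //; exact: ltW. Qed.

(* Greedy selection from large to small: sigma is the radius rounded up to the
   scale of i; balls of one scale are treated as translates, and a smaller ball
   meeting a selected one lies in the (1 + eta)-dilate of the latter. *)
Lemma scale_separated_packing (sigma : I -> R) q eta A : 0 <= q -> 0 <= eta ->
  (forall i, i \in A -> rad i <= sigma i <= q * rad i) ->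
  (forall i j, i \in A -> j \in A -> sigma i < sigma j -> 2 * sigma i <= eta * rad j) ->
  exists S,
  [/\ S \subset A,
      forall i j, i \in S -> j \in S -> i != j -> rad i + rad j < nrm (c i - c j) &
      (volume (\bigcup_(i in [set` A]) lpball p (c i) (rad i)) <=
       ((q ^+ d * M + (1 + eta) ^+ d) * \sum_(i in S) rad i ^+ d)%:E * kappa)%E].
Proof.
move=> q0 eta0; have [n] := ubnP #|A|; elim: n A => // n IHn A An sigA etaA.
have [k k0 kE] := volume_lp_ball_fin_pos d p1.
have [->|/finset.set0Pn[i0 i0A]] := eqVneq A finset.set0.
  exists finset.set0; split => //; first by move=> i j; rewrite inE.
  rewrite (_ : [set` finset.set0] = set0); last by apply/seteqP; split => i //=; rewrite inE.
  by rewrite bigcup_set0 volume_set0 big_set0 mulr0 mul0e.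
case: (@Order.TotalTheory.arg_maxP _ _ _ i0 (mem A) sigma i0A) => im /= imA maxim.
have {}imA : im \in A := imA.
set s := sigma im in maxim.
have s0 : 0 < s by apply: (lt_le_trans (rad0 im)); have /andP[] := sigA _ imA.
pose A1 := [set i in A | sigma i == s].
have A1P i : i \in A1 -> i \in A /\ sigma i = s by rewrite inE => /andP[? /eqP].
(* Balls of the top scale are all enlarged to radius [s]. Separation by 2s also separates the
   original balls, and comparing s^d with [rad i ^+ d] costs the factor q^d. *)
have [S1 [S1A sep1 vol1]] := translate_packing p1 c s0 A1.
have S1P i : i \in S1 -> i \in A /\ sigma i = s by move/(fintype.subsetP S1A); exact: A1P.
pose A2 :=
  [set i in A | (sigma i != s) && [forall (j | j \in S1), rad i + rad j < nrm (c i - c j)]].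
have A2A i : i \in A2 -> i \in A by rewrite inE => /andP[].
have [||| S2 [S2A sep2 vol2]] := IHn A2.
- rewrite -ltnS; apply: leq_trans An; rewrite ltnS.
  apply: proper_card; rewrite properE; apply/andP; split.
    by apply/fintype.subsetP => i; exact: A2A.
  apply/negP => /fintype.subsetP/(_ im imA).
  by rewrite inE imA/= -/s eqxx.
- by move=> i /A2A; exact: sigA.
- by move=> i j /A2A iA /A2A; exact: etaA.
have S2P i : i \in S2 -> [/\ i \in A, sigma i != s &
    forall j, j \in S1 -> rad i + rad j < nrm (c i - c j)].
  by move=> /(fintype.subsetP S2A); rewrite inE => /andP[iA /andP[si /forall_inP]].
have rad_le i : i \in A -> rad i <= sigma i by move/sigA => /andP[].
exists (S1 :|: S2); split.
- apply/fintype.subsetP => i; rewrite finset.in_setU => /orP[/S1P[]//|/S2P[]//].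
- move=> i j; rewrite !finset.in_setU => /orP[iS|iS] /orP[jS|jS] ij.
  + apply: le_lt_trans (sep1 _ _ iS jS ij).
    have [iA si] := S1P _ iS; have [jA sj] := S1P _ jS.
    by have := rad_le _ iA; have := rad_le _ jA; rewrite si sj; lra.
  + by rewrite addrC (lpnormB p1); have [_ _] := S2P _ jS; exact.
  + by have [_ _] := S2P _ iS; exact.
  + exact: sep2.
have disj i : i \in S1 -> i \in S2 -> False.
  by move=> /S1P[_ si] /S2P[_]; rewrite si eqxx.
pose B1 := \bigcup_(i in [set` A1]) lpball p (c i) s.
pose B2 := \bigcup_(i in [set` S1]) lpball p (c i) ((1 + eta) * rad i).
pose B3 := \bigcup_(i in [set` A2]) lpball p (c i) (rad i).
have mB1 : vmeasurable B1.
  by apply: vmeasurable_bigcup => i _; apply: vmeasurable_lpball => //; exact: ltW.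
have e1 : 0 < 1 + eta by lra.
have mdil i : vmeasurable (lpball p (c i) ((1 + eta) * rad i)).
  by apply: vmeasurable_lpball => //; rewrite mulr_ge0// ltW.
have mB2 : vmeasurable B2 by exact: vmeasurable_bigcup.
have mB3 : vmeasurable B3 by exact: vmeasurable_bigcup.
have mA : vmeasurable (\bigcup_(i in [set` A]) lpball p (c i) (rad i)).
  exact: vmeasurable_bigcup.
have sub : \bigcup_(i in [set` A]) lpball p (c i) (rad i) `<=` B1 `|` (B2 `|` B3).
  move=> x [i /= iA xi].
  have [si|si] := eqVneq (sigma i) s.
    left; exists i; first by rewrite /= inE iA si eqxx.
    by rewrite /lpball/= (le_trans xi)// -si rad_le.
  right; have [h|h] := boolP [forall (j | j \in S1), rad i + rad j < nrm (c i - c j)].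
    by right; exists i => //; rewrite /= inE iA si.
  left; move: h; rewrite negb_forall_in => /exists_inP[j jS1]; rewrite -leNgt => ij.
  exists j => //; rewrite /lpball/=.
  have -> : x - c j = (x - c i) + (c i - c j) by rewrite addrA subrK.
  apply: (le_trans (lpnorm_triangle p1 _ _)).
  have [jA sj] := S1P _ jS1.
  (* The distance from x to [c j] is at most 2 [rad i] + [rad j], so the diameter of the smaller
     ball must fit into [eta * rad j]. *)
  have : 2 * sigma i <= eta * rad j.
    by apply: etaA => //; rewrite sj lt_neqAle si maxim.
  by have := rad_le _ iA; move: xi; rewrite /lpball/=; lra.
have v3 : (volume (B1 `|` (B2 `|` B3)) <= volume B1 + (volume B2 + volume B3))%E.
  apply: (le_trans (volumeU_le mB1 (vmeasurableU mB2 mB3))).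
  by rewrite leeD2l// volumeU_le.
have mU : vmeasurable (B1 `|` (B2 `|` B3)) by do 2! apply: vmeasurableU => //.
apply: (le_trans (le_volume mA mU sub)); apply: (le_trans v3).
have vB2 : (volume B2 <= ((1 + eta) ^+ d * (\sum_(i in S1) rad i ^+ d) * k)%:E)%E.
  apply: (le_trans (volume_bigcup_le (fun i _ => mdil i))).
  rewrite mulr_sumr mulr_suml -sumEFin; apply: lee_sum => i _.
  by rewrite volume_lpball// ?mulr_gt0// kE -EFinM exprMn.
have /andP[dl0 dl1] := lp_delta_bounds p1.
have M0 : 0 <= M by rewrite addr_ge0// exprn_ge0//; lra.
have vB1 : (volume B1 <= (q ^+ d * M * (\sum_(i in S1) rad i ^+ d) * k)%:E)%E.
  apply: (le_trans vol1); rewrite kE -EFinM lee_fin ler_wpM2r// ?(ltW k0)//.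
  rewrite mulrCA [q ^+ d * _]mulrC -mulrA; apply: ler_wpM2l => //.
  rewrite mulr_sumr mulr_natl -sumr_const; apply: ler_sum => i /S1P[iA si].
  rewrite -exprMn lerXn2r ?nnegrE ?(ltW s0)//; last by rewrite -si; have /andP[] := sigA _ iA.
  by rewrite mulr_ge0// ltW.
apply: (le_trans (leeD vB1 (leeD vB2 vol2))).
rewrite kE -EFinM -!EFinD lee_fin [\sum_(i in S1 :|: S2) _](big_setID S1)/=.
rewrite (_ : (S1 :|: S2) :&: S1 = S1); last first.
  by apply/finset.setP => i; rewrite !inE; case: (i \in S1); rewrite ?andbF ?andbT.
rewrite (_ : (S1 :|: S2) :\: S1 = S2); last first.
  apply/finset.setP => i; rewrite !inE.
  by case: (boolP (i \in S1)) => //= iS1; apply/esym/negbTE/negP => /(disj _ iS1).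
rewrite le_eqVlt; apply/orP; left; apply/eqP; ring.
Qed.

(* Scales are the powers of e^(1/d), split into m ~ d ln d residue classes:
   within a class the next smaller scale is smaller by a factor of at least d,
   so that (1 + eta)^d stays bounded, and the best class covers a 1/m share. *)
Lemma homothet_packing : (2 <= d)%N -> exists S,
  (forall i j, i \in S -> j \in S -> i != j -> rad i + rad j < nrm (c i - c j)) /\
  (volume (\bigcup_(i in [set: I]) lpball p (c i) (rad i)) <=
    ((d%:R * ln d%:R + 2) * (expR 1 * M + expR 2) * \sum_(i in S) rad i ^+ d)%:E * kappa)%E.
Proof.
move=> d2; have d0 : 0 < d%:R :> R by rewrite ltr0n (leq_trans _ d2).
have dn0 : d%:R != 0 :> R by rewrite gt_eqF.
have lnd : 0 < ln (d%:R : R) by rewrite ln_gt0// ltr1n.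
have dl0 : 0 <= d%:R * ln d%:R :> R by rewrite mulr_ge0// ltW.
have [k k0 kE] := volume_lp_ball_fin_pos d p1.
(* One unit makes up for the truncation, the other for the rounding up of radii in [sigma]: what is
   needed is m >= d ln d + 1. *)
pose m := (Num.truncn (d%:R * ln d%:R : R)).+2.
have /andP[m1 m2] := Num.Theory.truncn_itv dl0.
have mle : m%:R <= d%:R * ln d%:R + 2 :> R by rewrite /m -addn2 natrD lerD2r.
have mge : d%:R * ln d%:R + 1 <= m%:R :> R by rewrite /m -natr1 lerD2r ltW.
pose sc i : int := Num.floor (d%:R * ln (rad i)).
pose sigma i : R := expR ((sc i + 1)%:~R / d%:R).
have scP i : (sc i)%:~R <= d%:R * ln (rad i) < (sc i + 1)%:~R.
  by rewrite Num.Theory.floor_le Num.Theory.floorD1_gt.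
have sigP i : rad i <= sigma i <= expR (d%:R^-1) * rad i.
  have /andP[h1 h2] := scP i.
  have -> : rad i = expR (ln (rad i)) by rewrite lnK// posrE.
  rewrite /sigma -expRD !ler_expR ler_pdivlMr// ler_pdivrMr//.
  rewrite mulrDl mulVf// [ln _ * _]mulrC (ltW h2)/=.
  by rewrite intrD addrC lerD2l.
have m0 : (0 < m)%N by [].
(* The integer remainder already lies between 0 and m - 1; the second reduction only supplies the
   bound demanded by the ordinal type. *)
pose res i : 'I_m := Ordinal (ltn_pmod `|(sc i %% m)%Z|%N m0).
pose A j : {set I} := [set i | res i == j]%SET.
have resP i i' : res i = res i' -> sc i < sc i' -> sc i + m%:Z <= sc i'.
  move=> [] h lt.
  have mz : (m%:Z != 0) by [].
  have E t : (`|(sc t %% m)%Z| %% m)%N = `|(sc t %% m)%Z|%N.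
    rewrite modn_small// -ltz_nat gez0_abs ?modz_ge0//.
    by rewrite ltz_pmod.
  move: h; rewrite !E => /(congr1 Posz); rewrite !gez0_abs ?modz_ge0// => h.
  have : (m%:Z %| sc i' - sc i)%Z by rewrite -eqz_mod_dvd; apply/eqP.
  move=> /dvdzP[t tE].
  have tp : 0 < t.
    have : 0 < t * m%:Z by rewrite -tE subr_gt0.
    by rewrite pmulr_lgt0.
  rewrite addrC -lerBrDr tE ler_peMl// -[1]/(0 + 1) lezD1//.
(* This choice turns the condition on scales into a drop by a factor d, and keeps (1 + eta)^d below
   e^2. *)
pose eta : R := 2 / d%:R.
have sep j : exists S,
  [/\ S \subset A j,
      forall i j, i \in S -> j \in S -> i != j -> rad i + rad j < nrm (c i - c j) &
      (volume (\bigcup_(i in [set` A j]) lpball p (c i) (rad i)) <=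
       (((expR d%:R^-1) ^+ d * M + (1 + eta) ^+ d) * \sum_(i in S) rad i ^+ d)%:E * kappa)%E].
  apply: (@scale_separated_packing sigma); rewrite ?expR_ge0//.
  - by rewrite divr_ge0// ltW.
  - move=> i i'; rewrite !inE => /eqP ij /eqP i'j; rewrite /sigma ltr_expR.
    rewrite ltr_pM2r ?invr_gt0// ltr_int ltrD2r => lt.
    have h := resP _ _ (etrans ij (esym i'j)) lt.
    rewrite /eta -mulrA ler_pM2l//.
    have /andP[h1 _] := scP i'.
    have -> : d%:R^-1 * rad i' = expR (ln (rad i') - ln d%:R).
      by rewrite expRD expRN !lnK ?posrE// mulrC.
    rewrite ler_expR ler_pdivrMr//.
    have : (sc i + m%:Z)%:~R <= (sc i')%:~R :> R by rewrite ler_int.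
    rewrite !intrD; move: h1 mge; rewrite /= -[m%:Z%:~R]/(m%:R : R); lra.
have [S SP] := choice sep.
case: (@Order.TotalTheory.arg_maxP _ _ _ (Ordinal m0) xpredT
  (fun j => \sum_(i in S j) rad i ^+ d) isT) => jm _ maxj.
exists (S jm); split; first by have [] := SP jm.
pose U j := \bigcup_(i in [set` A j]) lpball p (c i) (rad i).
have mU j : vmeasurable (U j) by exact: vmeasurable_bigcup.
have sub : \bigcup_(i in [set: I]) lpball p (c i) (rad i) `<=`
    \bigcup_(j in [set` [set: 'I_m]%SET]) U j.
  move=> x [i _ xi]; exists (res i); first by rewrite /= inE.
  by exists i => //; rewrite /= inE.
have mT : vmeasurable (\bigcup_(i in [set: I]) lpball p (c i) (rad i)).
  rewrite (_ : [set: I] = [set` [set: I]%SET]); last first.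
    by apply/seteqP; split => i //= _; rewrite inE.
  exact: vmeasurable_bigcup.
have mTU : vmeasurable (\bigcup_(j in [set` [set: 'I_m]%SET]) U j) by exact: vmeasurable_bigcup.
apply: (le_trans (le_volume mT mTU sub)).
apply: (le_trans (volume_bigcup_le (fun j _ => mU j))).
have /andP[dl0' dl1] := lp_delta_bounds p1.
have M0 : 0 <= M by rewrite addr_ge0// exprn_ge0//; lra.
have e0 : 0 <= expR 1 * M + expR 2 by rewrite addr_ge0 ?mulr_ge0 ?expR_ge0.
have sum0 : 0 <= \sum_(i in S jm) rad i ^+ d.
  by apply: sumr_ge0 => i _; rewrite exprn_ge0// ltW.
apply: (@le_trans _ _ (\sum_(j in [set: 'I_m]%SET)
  (((expR 1 * M + expR 2) * \sum_(i in S jm) rad i ^+ d) * k)%:E)%E).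
  apply: lee_sum => j _; have [_ _ vj] := SP j.
  apply: (le_trans vj); rewrite kE -EFinM lee_fin ler_wpM2r ?(ltW k0)//.
  apply: ler_pM => //; last exact: maxj.
  - by rewrite addr_ge0 ?mulr_ge0 ?exprn_ge0 ?expR_ge0// addr_ge0// divr_ge0// ltW.
  - by apply: sumr_ge0 => i _; rewrite exprn_ge0// ltW.
  rewrite -expRM_natl mulfV// lerD2l.
  apply: (@le_trans _ _ (expR eta ^+ d)).
    rewrite lerXn2r ?nnegrE ?expR_ge0 ?expR_ge1Dx//.
    by rewrite addr_ge0// divr_ge0// ltW.
  by rewrite -expRM_natl /eta mulrC divfK.
rewrite sumEFin sumr_const cardsT card_ord kE -EFinM lee_fin.
rewrite -[X in X <= _]mulr_natl mulrA ler_wpM2r ?(ltW k0)// mulrA ler_wpM2r//.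
by rewrite ler_wpM2r.
Qed.

End HomothetPacking.

(** * The largest admissible fraction is attained *)

Section LargestFraction.
Context {R : realType} {d : nat}.
Implicit Types (P C S : set (set 'rV[R]_d)) (c : R).

(** One disjoint subfamily that serves every admissible constant at once; this lets admissibility
    pass to the supremum. *)
Lemma finite_disjoint_maximum C : finite_set C -> exists S,
  [/\ S `<=` C, trivIset S id & forall S', S' `<=` C -> trivIset S' id ->
    (volume (\bigcup_(K in S') K) <= volume (\bigcup_(K in S) K))%E].
Proof.
move=> /finite_seqP[s ->].
pose I := seq_sub s.
pose sets (T : {set I}) : set (set 'rV[R]_d) := [set (ssval i : set 'rV[R]_d) | i in [set` T]].
pose Q (T : {set I}) := `[< trivIset (sets T) id >].
have Q0 : Q finset.set0.
  by apply/asboolP => K K' [i + _]; rewrite /= inE.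
case: (@Order.TotalTheory.arg_maxP _ _ _ finset.set0 Q
  (fun T => volume (\bigcup_(K in sets T) K)) Q0) => T /asboolP trT maxT.
exists (sets T); split => //; first by move=> _ [i _ <-]; exact: (ssvalP i).
move=> S' S's trS'.
pose T' : {set I} := [set i | `[< S' (ssval i) >]]%SET.
have E : sets T' = S'.
  apply/seteqP; split => [_ [i + <-]|K S'K].
    by rewrite /= inE => /asboolP.
  have Ks : K \in s by exact: S's.
  by exists (SeqSub Ks) => //=; rewrite inE; apply/asboolP.
by have := maxT T'; rewrite /Q E; apply; apply/asboolP.
Qed.

(** [xget] would return its default 0 if no greatest constant existed, so the supremum has to be
    shown admissible. The family consisting of [K0] alone bounds all admissible constants by 1. *)
Lemma le_largest_disjoint_fraction P (K0 : set 'rV[R]_d) c : P K0 ->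
  (0 < volume K0)%E -> (volume K0 < +oo)%E ->
  disjoint_fraction P c -> c <= largest_disjoint_fraction P.
Proof.
move=> PK0 v0 voo Pc.
have K0_ub c' : disjoint_fraction P c' -> c' <= 1.
  move=> [c'0 /(_ [set K0] (finite_set1 _))[|S [SK _]]]; first by move=> _ ->.
  rewrite bigcup_set1 => h.
  have : (volume (\bigcup_(K' in S) K') <= volume K0)%E.
    have [SK0|SK0] := pselect (S K0).
      by rewrite (_ : S = [set K0]) ?bigcup_set1//; apply/seteqP; split => // _ ->.
    rewrite (_ : S = set0) ?bigcup_set0 ?volume_set0 ?volume_ge0//.
    by apply/seteqP; split => // K SK'; have K0E := SK _ SK'; rewrite K0E in SK'.
  move=> /(le_trans h); rewrite -{2}[volume K0]mul1e.
  have fv : volume K0 \is a fin_num by rewrite ge0_fin_numE ?volume_ge0.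
  by rewrite lee_pmul2r.
pose D := disjoint_fraction P.
have hsD : has_sup D by split; [exists c|exists 1 => c'; exact: K0_ub].
have sup0 : 0 <= sup D.
  by apply: le_trans (proj1 Pc) _; exact: ub_le_sup hsD.2 _ Pc.
have Dsup : D (sup D).
  split => // C finC CP.
  have [S [SC trS maxS]] := finite_disjoint_maximum finC.
  exists S; split => //.
  have le_max c' : D c' -> (c'%:E * volume (\bigcup_(K' in C) K') <=
      volume (\bigcup_(K' in S) K'))%E.
    move=> [_ /(_ C finC CP)[S' [S'C trS' h]]]; apply: (le_trans h); exact: maxS.
  have := volume_ge0 (\bigcup_(K' in C) K').
  move: (volume (\bigcup_(K' in S) K')) (volume (\bigcup_(K' in C) K')) le_max
    (volume_ge0 (\bigcup_(K' in S) K')) => w [v| |]//.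
    move=> le_max w0; rewrite lee_fin le_eqVlt => /orP[/eqP<-|vp].
      by rewrite mule0.
    case: w w0 le_max => [w| |] // w0 le_max; last by rewrite leey.
    rewrite -EFinM lee_fin -ler_pdivlMr//.
    apply: ge_sup; first by exists c.
    by move=> c' /le_max; rewrite -EFinM lee_fin ler_pdivlMr.
  (* If the union has infinite volume, a single positive admissible constant already forces the
     chosen subfamily to have infinite volume. *)
  move=> le_max w0 _; have [<-|sp] := eqVneq 0 (sup D); first by rewrite mul0e.
  have {}sp : 0 < sup D by rewrite lt_neqAle sp.
  have [c' Dc' c'0] := sup_gt hsD.1 sp.
  by have := le_max _ Dc'; rewrite !gt0_muley ?lte_fin.
have ex : exists x, (D `&` ubound D) x.
  by exists (sup D); split => // c' Dc'; exact: ub_le_sup hsD.2 _ Dc'.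
by have [_] := @xgetPex _ 0 _ ex; apply.
Qed.

End LargestFraction.

Section LpFraction.
Context {R : realType} (p : R) (d : nat).
Hypothesis p1 : 1 < p.

Local Notation kappa := (volume (lp_ball (R := R) d p)).

(** Passes from families of sets to indexed centers and radii, which are picked by choice. [Q] is r
    = 1 for translates and no condition for homothetic copies. *)
Lemma lp_disjoint_fraction (P : set (set 'rV[R]_d)) (Q : R -> Prop) (X : R) : 0 < X ->
  (forall K, P K -> exists v r, [/\ 0 < r, Q r & K = lpball p v r]) ->
  (forall (I : finType) (c : I -> 'rV[R]_d) (rad : I -> R),
    (forall i, 0 < rad i) -> (forall i, Q (rad i)) -> exists S : {set I},
    (forall i j, i \in S -> j \in S -> i != j -> rad i + rad j < lpnorm p (c i - c j)) /\
    (volume (\bigcup_(i in [set: I]) lpball p (c i) (rad i)) <=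
      (X * \sum_(i in S) rad i ^+ d)%:E * kappa)%E) ->
  disjoint_fraction P X^-1.
Proof.
move=> X0 PQ H; split; first by rewrite invr_ge0 ltW.
move=> C /finite_seqP[s ->] sP.
pose I := seq_sub s.
have fex (i : I) : exists f : 'rV[R]_d * R,
    [/\ 0 < f.2, Q f.2 & (ssval i : set 'rV[R]_d) = lpball p f.1 f.2].
  by have [v [r h]] := PQ _ (sP _ (ssvalP i)); exists (v, r).
have [f fP] := choice fex.
have rad0 i : 0 < (f i).2 by have [] := fP i.
have radQ i : Q (f i).2 by have [] := fP i.
have [S [sep vol]] := H I (fst \o f) (snd \o f) rad0 radQ.
have ballE i : (ssval i : set 'rV[R]_d) = lpball p (f i).1 (f i).2 by have [] := fP i.
have disj i j : i \in S -> j \in S -> i != j ->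
    lpball p (f i).1 (f i).2 `&` lpball p (f j).1 (f j).2 = set0.
  move=> iS jS ij; apply/seteqP; split => // x [xi xj].
  have := sep _ _ iS jS ij; rewrite ltNge => /negP; apply => /=.
  have -> : (f i).1 - (f j).1 = (x - (f j).1) - (x - (f i).1).
    by apply/rowP => k; rewrite !mxE; ring.
  apply: (le_trans (lpnorm_triangle p1 _ _)); rewrite (lpnormN p1).
  by move: xi xj; rewrite /lpball/=; lra.
exists [set (ssval i : set 'rV[R]_d) | i in [set` S]]; split.
- by move=> _ [i _ <-]; exact: (ssvalP i).
- move=> _ _ [i iS <-] [j jS <-]; rewrite !ballE => -[x xij].
  have [->//|ij] := eqVneq i j.
  by move: xij; rewrite disj.
rewrite bigcup_image.
have [k k0 kE] := volume_lp_ball_fin_pos d p1.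
have mb i : vmeasurable (lpball p (f i).1 (f i).2).
  by apply: vmeasurable_lpball => //; exact: ltW.
have -> : volume (\bigcup_(i in [set` S]) (ssval i : set 'rV[R]_d)) =
    ((\sum_(i in S) (f i).2 ^+ d)%:E * kappa)%E.
  rewrite (eq_bigcupr (fun i _ => ballE i)) volume_bigcup//.
  rewrite kE -EFinM mulr_suml -sumEFin; apply: eq_bigr => i _.
  by rewrite volume_lpball// kE.
have -> : \bigcup_(K in [set` s]) K = \bigcup_(i in [set: I]) lpball p (f i).1 (f i).2.
  apply/seteqP; split => x.
    by move=> [K /= Ks Kx]; exists (SeqSub Ks) => //; rewrite -ballE.
  by move=> [i _]; rewrite -ballE => xi; exists (ssval i) => //; exact: (ssvalP i).
apply: (@le_trans _ _ (X^-1%:E * ((X * \sum_(i in S) (f i).2 ^+ d)%:E * kappa))%E).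
  by apply: lee_wpmul2l => //; rewrite lee_fin invr_ge0 ltW.
by rewrite kE -!EFinM lee_fin !mulrA mulVf ?gt_eqF// mul1r.
Qed.

Let ball1 : (volume (lp_ball (R := R) d p) > 0)%E /\ (volume (lp_ball (R := R) d p) < +oo)%E.
Proof. by have [k k0 ->] := volume_lp_ball_fin_pos d p1; rewrite lte_fin ltry. Qed.

Lemma fconst_lp_ball_ge : (2 ^+ d + (3 - 2 * lp_delta p) ^+ d)^-1 <= fconst (lp_ball (R := R) d p).
Proof.
have /andP[d0 d1] := lp_delta_bounds p1.
have [v0 voo] := ball1.
apply: (le_largest_disjoint_fraction (K0 := lp_ball (R := R) d p)) => //.
  by exists 0; rewrite -[LHS]image_id; apply: eq_imagel => x _; rewrite add0r.
apply: (lp_disjoint_fraction (Q := fun r => r = 1)).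
- by rewrite addr_gt0// exprn_gt0//; lra.
- move=> _ [v ->]; exists v, 1; split => //.
  rewrite -(lpball_homothetic p1)//; apply: eq_imagel => x _.
  by rewrite scale1r.
move=> I c rad _ rad1.
have [S [_ sep vol]] := translate_packing p1 c ltr01 [set: I]%SET.
exists S; split.
  by move=> i j iS jS ij; rewrite !rad1; have := sep _ _ iS jS ij; lra.
move: vol; rewrite expr1n mulr1 (_ : [set` [set: I]%SET] = [set: I]); last first.
  by apply/seteqP; split => i //= _; rewrite inE.
rewrite (eq_bigcupr (G := fun i => lpball p (c i) (rad i))); last first.
  by move=> i _; rewrite rad1.
move=> /le_trans; apply; rewrite mulrC.
under [in leRHS]eq_bigr do rewrite rad1 expr1n.
by rewrite sumr_const.
Qed.

Lemma Fconst_lp_ball_ge : (2 <= d)%N ->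
  ((d%:R * ln d%:R + 2) * (expR 1 * (2 ^+ d + (3 - 2 * lp_delta p) ^+ d) + expR 2))^-1
  <= Fconst (lp_ball (R := R) d p).
Proof.
move=> d2; have /andP[d0 d1] := lp_delta_bounds p1.
have [v0 voo] := ball1.
have dl0 : 0 <= d%:R * ln d%:R :> R.
  by rewrite mulr_ge0// ln_ge0// ler1n (leq_trans _ d2).
apply: (le_largest_disjoint_fraction (K0 := lp_ball (R := R) d p)) => //.
  exists 0, 1; split => //.
  by rewrite -[LHS]image_id; apply: eq_imagel => x _; rewrite add0r scale1r.
apply: (lp_disjoint_fraction (Q := fun=> True)).
- rewrite mulr_gt0//; first by lra.
  by rewrite addr_gt0 ?expR_gt0// mulr_gt0 ?expR_gt0// addr_gt0// exprn_gt0//; lra.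
- move=> _ [v [r [r0 ->]]]; exists v, r; split => //.
  exact: lpball_homothetic.
by move=> I c rad rad0 _; exact: homothet_packing.
Qed.

End LpFraction.

(** * Asymptotics *)

Section Asymptotics.
Context {R : realType}.

(** The rate 1/sqrt n is deliberately crude: it dominates both 1/n and (ln n)/n, so it covers the
    two error terms of the theorem. *)
Lemma cvg0_sqrt_bound (u : nat -> R) (K : R) :
  (forall n, (2 <= n)%N -> `|u n| <= K / Num.sqrt n%:R) -> u n @[n --> \oo] --> 0.
Proof.
move=> uK; apply/cvgrPdist_lt => e e0; near=> n.
have n2 : (2 <= n)%N by near: n; exact: nbhs_infty_ge.
have nK : (`|K| / e) ^+ 2 < n%:R :> R.
  have nt : ((Num.truncn ((`|K| / e) ^+ 2)).+1 <= n)%N by near: n; exact: nbhs_infty_ge.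
  have /andP[_ h] := Num.Theory.truncn_itv (sqr_ge0 (`|K| / e)).
  by apply: (lt_le_trans h); rewrite ler_nat.
have s0 : 0 < Num.sqrt (n%:R : R) by rewrite sqrtr_gt0 ltr0n (leq_trans _ n2).
rewrite sub0r normrN; apply: (le_lt_trans (uK _ n2)).
rewrite ltr_pdivrMr// mulrC -ltr_pdivrMr//.
apply: (@le_lt_trans _ _ (`|K| / e)).
  by rewrite ler_wpM2r ?invr_ge0 ?(ltW e0)// ler_norm.
have -> : `|K| / e = Num.sqrt ((`|K| / e) ^+ 2).
  by rewrite sqrtr_sqr [RHS]ger0_norm// divr_ge0// ltW.
by rewrite ltr_sqrt// ltr0n (leq_trans _ n2).
Unshelve. all: end_near. Qed.

Lemma ln_le_sqrt (n : nat) : (0 < n)%N -> ln n%:R <= 2 * Num.sqrt n%:R :> R.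
Proof.
move=> n0; have s0 : 0 < Num.sqrt (n%:R : R) by rewrite sqrtr_gt0 ltr0n.
have {1}-> : n%:R = Num.sqrt (n%:R : R) ^+ 2 by rewrite sqr_sqrtr// ler0n.
by rewrite lnXn// mulr2n; have := ln_sublinear s0; lra.
Qed.

Lemma inv_le_inv_sqrt (n : nat) : (0 < n)%N -> n%:R^-1 <= (Num.sqrt n%:R)^-1 :> R.
Proof.
move=> n0; have s0 : 0 < Num.sqrt (n%:R : R) by rewrite sqrtr_gt0 ltr0n.
rewrite lef_pV2 ?posrE ?ltr0n//.
rewrite -{2}(sqr_sqrtr (ler0n R n)) expr2 ler_peMl ?(ltW s0)//.
by rewrite -[leLHS](@sqrtr1 R) ler_sqrt ?ler1n ?ler0n.
Qed.

Lemma half_le_ln2 : 2^-1 <= ln 2 :> R.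
Proof.
have h : -1 < - 2^-1 :> R by lra.
have := le_ln1Dx h; have -> : 1 - 2^-1 = 2^-1 :> R by field.
by rewrite lnV ?posrE// lerN2.
Qed.

Lemma n_ln_n_ge (n : nat) : (2 <= n)%N -> n%:R / 2 <= n%:R * ln n%:R :> R.
Proof.
move=> n2; apply: ler_wpM2l => //; apply: (le_trans half_le_ln2).
by rewrite ler_ln ?posrE ?ltr0n ?(leq_trans _ n2)// ler_nat.
Qed.

Lemma ln_inv3 (x y z : R) : 0 < x -> 0 < y -> 0 < z ->
  ln (x^-1 * y^-1 * z^-1) = - (ln x + ln y + ln z).
Proof.
by move=> x0 y0 z0; rewrite -!invfM lnV ?posrE ?mulr_gt0// !lnM ?posrE ?mulr_gt0.
Qed.

(* The factor (1 + 2 / (n ln n)) (e + e^2 / 2^n) lost in passing from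
   translates to homothetic copies. *)
Definition homothety_loss (n : nat) : R :=
  (n%:R * ln n%:R + 2) * (expR 1 + expR 2 / 2 ^+ n) / (n%:R * ln n%:R).

Lemma homothety_loss_bounds (n : nat) : (2 <= n)%N ->
  expR 1 <= homothety_loss n <= expR 1 + (4 * expR 1 + 5 * expR 2) / n%:R.
Proof.
move=> n2; have n0 : 0 < n%:R :> R by rewrite ltr0n (leq_trans _ n2).
have n2' : 2 <= n%:R :> R by rewrite ler_nat.
have := n_ln_n_ge n2; set t := n%:R * ln n%:R => tn.
have t0 : 0 < t by lra.
have E : homothety_loss n = (1 + 2 / t) * (expR 1 + expR 2 / 2 ^+ n).
  by rewrite /homothety_loss -/t; field; rewrite ?gt_eqF ?exprn_gt0.
have a0 : 0 <= 2 / t by rewrite divr_ge0// ltW.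
have a1 : 2 / t <= 4 / n%:R by rewrite ler_pdivrMr// mulrAC ler_pdivlMr//; lra.
have b0 : 0 <= (2 ^+ n)^-1 :> R by rewrite invr_ge0 exprn_ge0.
have b1 : (2 ^+ n)^-1 <= n%:R^-1 :> R.
  by rewrite lef_pV2 ?posrE ?exprn_gt0// -natrX ler_nat ltnW// ltn_expl.
have ni : 4 / n%:R <= 2 :> R by rewrite ler_pdivrMr//; lra.
have e1 := expR_gt0 (1 : R); have e2 := expR_gt0 (2 : R).
rewrite E; move: (2 / t) (2 ^+ n)^-1 n%:R^-1 a0 a1 b0 b1 ni => a b c a0 a1 b0 b1 ni.
have ab : a * b <= 2 * c.
  by apply: ler_pM => //; lra.
have h1 := ler_wpM2l (ltW e2) ab.
have h2 := ler_wpM2l (ltW e2) b1.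
have h3 := ler_wpM2l (ltW e1) a1.
have h4 : 0 <= a * expR 1 by rewrite mulr_ge0// ltW.
have h5 : 0 <= expR 2 * b by rewrite mulr_ge0// ltW.
have h6 : 0 <= a * (expR 2 * b) by rewrite mulr_ge0.
have c0 : 0 <= c by lra.
have h7 : 0 <= expR 2 * c by rewrite mulr_ge0// ltW.
apply/andP; split; lra.
Qed.

End Asymptotics.

Theorem theorem3p4 (R : realType) (p : R) (hp : 1 < p) :
  [/\ (p < 2 -> exists! delta : R, lp_delta_equation p delta),
      0 < lp_delta p,
      (forall d : nat, (2 <= d)%N ->
        (2 ^+ d + (3 - 2 * lp_delta p) ^+ d)^-1 <= fconst (lp_ball d p)) &
      exists o1 od : nat -> R,
        [/\ o1 d @[d --> \oo] --> (0 : R),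
            od d / d%:R @[d --> \oo] --> (0 : R) &
            forall d : nat, (2 <= d)%N ->
              let bound := (expR 1 + o1 d)^-1 * (d%:R * ln d%:R)^-1 *
                           (2 ^+ d + (3 - 2 * lp_delta p) ^+ d)^-1 in
              [/\ 0 < expR 1 + o1 d,
                  bound <= Fconst (lp_ball d p) &
                  bound = (3 - 2 * lp_delta p) `^ (- d%:R + od d)]]].
Proof.
have /andP[dl0 dl1] := lp_delta_bounds hp.
split => //; first by move=> _; exact: lp_delta_equation_unique.
  by move=> d _; exact: fconst_lp_ball_ge.
set b := 3 - 2 * lp_delta p.
have b2 : 2 < b by rewrite /b; lra.
have b0 : 0 < b by lra.
have lnb : 0 < ln b by rewrite ln_gt0//; lra.
pose M d : R := 2 ^+ d + b ^+ d.
have M0 d : 0 < M d by rewrite addr_gt0// exprn_gt0.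
pose bound d : R := (homothety_loss d)^-1 * (d%:R * ln d%:R)^-1 * (M d)^-1.
have loss0 d : (2 <= d)%N -> 0 < homothety_loss d :> R.
  by move=> /(@homothety_loss_bounds R)/andP[h _]; apply: lt_le_trans h; exact: expR_gt0.
have dlnd d : (2 <= d)%N -> 1 <= d%:R * ln d%:R :> R.
  move=> d2; apply: le_trans (n_ln_n_ge d2).
  by rewrite ler_pdivlMr// mul1r ler_nat.
have bound0 d : (2 <= d)%N -> 0 < bound d.
  move=> d2; rewrite !mulr_gt0 ?invr_gt0 ?loss0//.
  by apply: lt_le_trans (dlnd _ d2).
(* Both witnesses are read off from the required identities: [od] solves [bound] = b^(-d + od), so
   what remains is to show that [ln (bound d)] is -d ln b up to o(d). *)
exists (fun d => homothety_loss d - expR 1), (fun d => d%:R + ln (bound d) / ln b).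
split.
- apply: (@cvg0_sqrt_bound _ _ (4 * expR 1 + 5 * expR 2)) => d d2.
  have /andP[h1 h2] := @homothety_loss_bounds R _ d2.
  rewrite ger0_norm ?subr_ge0// lerBlDl (le_trans h2)// lerD2l ler_wpM2l//.
  by rewrite inv_le_inv_sqrt// (leq_trans _ d2).
- pose C0 : R := expR 1 + (4 * expR 1 + 5 * expR 2).
  (* The 5 is 4 + 1: ln(d ln d) <= 2 ln d <= 4 sqrt d, and the error 1 in [ln (M d)] is at most sqrt
     d. *)
  apply: (@cvg0_sqrt_bound _ _ ((ln C0 + 5) / ln b)) => d d2.
  have d0 : (0 < d)%N by rewrite (leq_trans _ d2).
  have d0' : 0 < d%:R :> R by rewrite ltr0n.
  have s0 : 0 < Num.sqrt (d%:R : R) by rewrite sqrtr_gt0.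
  have /andP[h1 h2] := @homothety_loss_bounds R _ d2.
  have e1 := expR_gt0 (1 : R); have e2 := expR_gt0 (2 : R).
  have lossC : homothety_loss d <= C0.
    apply: (le_trans h2); rewrite lerD2l ler_piMr//.
    by rewrite invf_le1// ler1n.
  have C0p : 0 < C0 by rewrite /C0; lra.
  have l1 : 1 <= ln (homothety_loss d : R).
    by rewrite -[leLHS]expRK ler_ln ?posrE ?loss0.
  have l2 : ln (homothety_loss d : R) <= ln C0 by rewrite ler_ln ?posrE ?loss0.
  have l3 : 0 <= ln (d%:R * ln d%:R : R) by apply: ln_ge0; exact: dlnd.
  have lnd0 : 0 < ln (d%:R : R) by rewrite ln_gt0// ltr1n.
  have l4 : ln (d%:R * ln d%:R : R) <= 2 * ln d%:R.
    rewrite lnM ?posrE// mulr_natl mulr2n lerD2l ler_ln ?posrE//.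
    exact/ltW/ln_sublinear.
  (* Since b > 2, [M d] lies between b^d and 2 b^d, and 2 <= e. *)
  have l5 : d%:R * ln b <= ln (M d) <= d%:R * ln b + 1.
    rewrite mulr_natl -lnXn// !ler_ln ?posrE ?exprn_gt0// lerDr exprn_ge0//=.
    have -> : ln (b ^+ d) + 1 = ln (b ^+ d * expR 1).
      by rewrite lnM ?posrE ?exprn_gt0// expRK.
    rewrite ler_ln ?posrE ?mulr_gt0 ?exprn_gt0//.
    have : 2 ^+ d <= b ^+ d by rewrite lerXn2r ?nnegrE ?ltW.
    have : 2 <= expR 1 :> R by have := expR_ge1Dx (1 : R); lra.
    have bd : 0 <= b ^+ d by rewrite exprn_ge0// ltW.
    by move=> /(ler_wpM2l bd); rewrite /M; lra.
  have -> : (d%:R + ln (bound d) / ln b) / d%:R =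
      - ((ln (homothety_loss d) + ln (d%:R * ln d%:R) + (ln (M d) - d%:R * ln b)) / ln b / d%:R).
    rewrite /bound ln_inv3 ?loss0//; last by apply: lt_le_trans (dlnd _ d2).
    move: (ln (homothety_loss d)) (ln (_ * _)) (ln (M d)) => x y z.
    by field; rewrite !gt_eqF.
  have /andP[l6 l7] := l5.
  rewrite normrN ger0_norm; last by rewrite !divr_ge0 ?(ltW lnb)//; lra.
  rewrite [leRHS]mulrAC [leLHS]mulrAC ler_wpM2r ?invr_ge0 ?(ltW lnb)//.
  rewrite ler_pdivrMr//.
  have -> : (ln C0 + 5) / Num.sqrt d%:R * d%:R = (ln C0 + 5) * Num.sqrt d%:R.
    rewrite -{2}(sqr_sqrtr (ler0n R d)); field; by rewrite gt_eqF.
  have s1 : 1 <= Num.sqrt (d%:R : R) by rewrite -[leLHS](@sqrtr1 R) ler_sqrt ?ler1n ?ler0n.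
  have ls := @ln_le_sqrt R _ d0.
  have lC : 0 <= ln C0 by lra.
  have := ler_wpM2l lC s1.
  lra.
- move=> d d2 /=; rewrite subrKC -/b -/(M d) -/(bound d).
  split; first exact: loss0.
    apply: le_trans (Fconst_lp_ball_ge hp d2).
    rewrite -/b -/(M d) /bound -!invfM lef_pV2 ?posrE; last 2 first.
    - apply: mulr_gt0 => //; apply: mulr_gt0; first exact: loss0.
      exact: lt_le_trans (dlnd _ d2).
    - have := dlnd _ d2; have e1 := expR_gt0 (1 : R); have e2 := expR_gt0 (2 : R).
      by move=> ?; apply: mulr_gt0; [lra|apply: addr_gt0 => //; exact: mulr_gt0].
    have t0 : 0 < d%:R * ln d%:R :> R by apply: lt_le_trans (dlnd _ d2).
    (* The additive e^2 of [homothet_packing] is absorbed as (e^2 / 2^d) [M d], because [M d] is at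
       least 2^d. *)
    rewrite /homothety_loss divfK ?gt_eqF// -mulrA ler_wpM2l//; first by lra.
    rewrite mulrDl lerD2l -mulrA ler_peMr ?expR_ge0//.
    rewrite ler_pdivlMl ?exprn_gt0// mulr1 lerDl exprn_ge0//; exact: ltW.
  have -> : - d%:R + (d%:R + ln (bound d) / ln b) = ln (bound d) / ln b by ring.
  rewrite /powR gt_eqF// divfK ?gt_eqF// lnK// posrE; exact: bound0.
Qed.
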